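(* Let $n\ge 1$ and $T\ge 2$ be integers and let $G=([T],\mathcal{E})$ be a connected undirected graph. Let $D\in\{0,-1,+1\}^{|\mathcal{E}|\times T}$ be the incidence matrix of $G$ for some orientation of its edges, $L=D^\top D$ its Laplacian with eigenvalues $\lambda_1\ge\lambda_2\ge\cdots\ge\lambda_{T-1}\ge\lambda_T=0$, and $M:=D\otimes I_n$. For each $t\in[T]$ let $C_t\in\mathbb{R}^{m_t\times n}$, $x_t\in\mathbb{R}^n$, and observe $y_t=C_tx_t+\eta_t$. Let $x\in\mathbb{R}^{nT}$ and $\eta$ be the column-stackings of the $x_t$ and of the $\eta_t$, $y$ the stacking of the $y_t$, $C=\mathrm{blockdiag}(C_1,\dots,C_T)\in\mathbb{R}^{(\sum_t m_t)\times nT}$, and $O_T:=[C_1^\top\ C_2^\top\ \cdots\ C_T^\top]^\top$ (so $O_T^\top O_T=\sum_{t=1}^T C_t^\top C_t$). Assume $\lambda_{\min}(O_T^\top O_T)>0$, that $\eta$ is a centered $\sigma$-subgaussian random vector, and that $\|Mx\|_2^2\le S_T$. Let $b_1,b_2,b_3>0$ satisfy $$\lambda_{T-1}\ge b_1,\qquad \frac{\lambda_{\min}(O_T^\top O_T)}{T}\ge b_2,\qquad 2\|C\|_2\frac{\lambda_{\max}^{1/2}(O_T^\top O_T)}{\sqrt T}\le b_3.$$ Define, for $\mu>0$, $$\overline{\lambda'}(\mu)=\begin{cases}\dfrac{b_2^2}{2(b_2^2+b_3^2)}\mu b_1, & \text{if } \mu b_1<b_2+\dfrac{b_3^2-b_2^2}{2b_2},\\[2mm]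 \dfrac14\Big(1-\dfrac{\mu b_1-b_2}{\sqrt{b_3^2+(\mu b_1-b_2)^2}}\Big)\mu b_1+\dfrac{b_2}{4}+\dfrac{b_2(\mu b_1-b_2)-b_3^2}{4\sqrt{b_3^2+(\mu b_1-b_2)^2}}, & \text{if } \mu b_1\ge b_2+\dfrac{b_3^2-b_2^2}{2b_2},\end{cases}$$ and $\overline{\lambda}(\mu):=\max\{\overline{\lambda'}(\mu),\lambda_{\min}(C^\top C)\}$. Let $\mu>0$ and let $\hat x$ be the (unique) minimizer over $z\in\mathbb{R}^{nT}$ of $\frac12\|y-Cz\|_2^2+\frac{\mu}{2}\|Mz\|_2^2$. Then: (1) $\lambda_{\min}(\mu M^\top M+C^\top C)\ge\overline{\lambda}(\mu)$, and $\overline{\lambda'}(\mu)>0$; moreover, if $\mu b_1\ge b_2+\frac{b_3^2}{b_2}$ then $\overline{\lambda'}(\mu)\ge\frac{b_2}{4}$. (2) For any $\delta\in(0,e^{-1})$, with probability at least $1-\delta$, $$\|\hat x-x\|_2^2\le\frac{4\mu}{\overline{\lambda}(\mu)}S_T+40n\sigma^2\|C\|_2^2\Big(\sum_{t=1}^{T-1}\frac{1}{(\overline{\lambda}(\mu)+\mu\lambda_t)^2}+\frac{1}{\overline{\lambda}^2(\mu)}\Big)\log\Big(\frac1\delta\Big).$$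
   Context: A random vector $Y\in\mathbb{R}^N$ is centered $\sigma$-subgaussian if $\mathbb{E}[Y]=0$ and $\mathbb{E}[e^{s\,u^\top Y}]\le e^{s^2\sigma^2/2}$ for all $s\in\mathbb{R}$ and all unit vectors $u\in\mathbb{R}^N$. Eigenvalues of symmetric matrices are ordered decreasingly; $\lambda_{\min},\lambda_{\max}$ denote the smallest and largest eigenvalue; $\|\cdot\|_2$ of a matrix is its spectral norm. $\otimes$ is the Kronecker product. *)

(* Defs.v *)
From HB Require Import structures.
From mathcomp Require Import all_boot all_order all_algebra.
From mathcomp Require Import all_classical all_reals all_analysis.
From mathcomp Require Export mxtens.
Set Implicit Arguments. Unset Strict Implicit. Unset Printing Implicit Defensive.
Import Order.TTheory GRing.Theory Num.Theory.
Local Open Scope ring_scope.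

Section Defs.
Variable R : realType.

(** Sorted (decreasingly) list of eigenvalues of a square matrix, with
    multiplicity: the roots of its characteristic polynomial, when that
    polynomial splits over R (always the case for symmetric matrices). *)
Definition spectrum k (A : 'M[R]_k) : seq R :=
  match pselect (exists s : seq R, sorted >=%R s /\
                   char_poly A = \prod_(x <- s) ('X - x%:P)) with
  | left h => projT1 (cid h)
  | right _ => [::]
  end.

(** eig A i = (i+1)-th largest eigenvalue (0-indexed: eig A 0 = lambda_1). *)
Definition eig k (A : 'M[R]_k) (i : nat) : R := nth 0 (spectrum A) i.
Definition lambda_max k (A : 'M[R]_k) : R := head 0 (spectrum A).
Definition lambda_min k (A : 'M[R]_k) : R := last 0 (spectrum A).

Definition sqnorm k (v : 'cV[R]_k) : R := \sum_i (v i 0) ^+ 2.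

Definition specnorm p q (A : 'M[R]_(p, q)) : R := Num.sqrt (lambda_max (A^T *m A)).

Definition incidence (E T : nat) (src dst : 'I_E -> 'I_T) : 'M[R]_(E, T) :=
  \matrix_(e, t) (if t == src e then 1 else if t == dst e then -1 else 0).

Lemma sum_const_n (T n : nat) : (\sum_(t < T) n)%N = (T * n)%N.
Proof. by rewrite sum_nat_const card_ord. Qed.

(** C = blockdiag(C_1, ..., C_T), columns indexed by t*n + i *)
Definition blockdiag (T n : nat) (m : 'I_T -> nat) (Ct : forall t, 'M[R]_(m t, n))
  : 'M[R]_(\sum_t m t, T * n) :=
  castmx (erefl _, sum_const_n T n)
    (@mxblock R T T m (fun _ => n) (fun i j => if i == j then Ct i else 0)).

Definition obsmx (T n : nat) (m : 'I_T -> nat) (Ct : forall t, 'M[R]_(m t, n))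
  : 'M[R]_(\sum_t m t, n) := \mxcol_(t < T) Ct t.

Definition lbar' (b1 b2 b3 mu : R) : R :=
  let a := mu * b1 in
  if a < b2 + (b3 ^+ 2 - b2 ^+ 2) / (2 * b2) then
    b2 ^+ 2 / (2 * (b2 ^+ 2 + b3 ^+ 2)) * a
  else
    1 / 4 * (1 - (a - b2) / Num.sqrt (b3 ^+ 2 + (a - b2) ^+ 2)) * a + b2 / 4
    + (b2 * (a - b2) - b3 ^+ 2) / (4 * Num.sqrt (b3 ^+ 2 + (a - b2) ^+ 2)).

Definition centered_subgaussian d (Omega : measurableType d)
  (P : probability Omega R) (N : nat) (Y : Omega -> 'cV[R]_N) (sigma : R) : Prop :=
  [/\ (forall i, measurable_fun setT (fun w => Y w i 0)),
      (forall i, P.-integrable setT (fun w => (Y w i 0)%:E)),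
      (forall i, (\int[P]_w (Y w i 0)%:E = 0%:E)%E) &
      (forall (s : R) (u : 'cV[R]_N), sqnorm u = 1 ->
         (\int[P]_w (expR (s * (u^T *m Y w) 0 0))%:E
            <= (expR (s ^+ 2 * sigma ^+ 2 / 2))%:E)%E)].
End Defs.

Definition graph_adj (E T : nat) (src dst : 'I_E -> 'I_T) : rel 'I_T :=
  fun a b => [exists e, ((src e == a) && (dst e == b)) || ((src e == b) && (dst e == a))].

(* Main.v *)
Require Import Defs.
From HB Require Import structures.
From mathcomp Require Import all_boot all_order all_algebra all_fingroup.
From mathcomp Require Import all_classical all_reals all_analysis.
From mathcomp Require Import mxtens complex measurable_realfun ring lra.
Import Order.TTheory GRing.Theory Num.Theory.
Import numFieldNormedType.Exports.
Local Open Scope classical_set_scope.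
Local Open Scope ring_scope.

(** Write [A = mu M^T M + C^T C].

    Lower bound: split [z = u + v] with [u] constant across the [T] blocks and
    [v] orthogonal to such vectors. The spectral gap gives [|M z|^2 >= b1 |v|^2],
    while [|C z|^2] is at least both [0] and [b2 |u|^2 - b3 |u| |v|]. Minimizing
    the resulting binary form in [(|u|, |v|)] yields twice [lbar'].

    Error: the normal equation reads [xhat - x = A^-1 C^T eta - v] with
    [A v = mu M^T M x], and pairing the latter with [v] gives
    [lb |v|^2 <= mu |M x|^2]. For the noise, the rows [b_i] of [N = A^-1 C^T] are
    handled one at a time: [|N eta|^2] is a convex combination of the
    [tr(N N^T) (b_i . eta)^2 / |b_i|^2], so Jensen's inequality reduces its
    exponential moment to that of a squared scalar subgaussian variable, which is
    computed by integrating the moment generating function against a Gaussian.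
    With the exponent [2/5] this moment is at most [sqrt 5 <= e], whence the
    factor [5] in the tail bound.

    Trace: [A >= (lb + mu L (x) 1) / 2] since [A] dominates both terms, and
    inversion is antitone, so [tr(A^-2) <= 4 n sum_t (lb + mu lambda_t)^-2]
    without any eigenvalue perturbation theory. *)

(** * The Euclidean inner product on column vectors *)

Section Dot.
Set Implicit Arguments. Unset Strict Implicit.
Context {R : realType}.

Definition dot k (u v : 'cV[R]_k) : R := (u^T *m v) 0 0.
Arguments dot {k}.

Lemma dotE k (u v : 'cV[R]_k) : dot u v = \sum_i u i 0 * v i 0.
Proof. by rewrite /dot mxE; apply: eq_bigr => i _; rewrite mxE. Qed.

Lemma dotC k (u v : 'cV[R]_k) : dot u v = dot v u.
Proof. by rewrite !dotE; apply: eq_bigr => i _; rewrite mulrC. Qed.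

Lemma dotDl k (u v w : 'cV[R]_k) : dot (u + v) w = dot u w + dot v w.
Proof. by rewrite /dot linearD/= mulmxDl mxE. Qed.

Lemma dotNl k (u v : 'cV[R]_k) : dot (- u) v = - dot u v.
Proof. by rewrite /dot linearN/= mulNmx mxE. Qed.

Lemma dotZl k a (u v : 'cV[R]_k) : dot (a *: u) v = a * dot u v.
Proof. by rewrite /dot linearZ/= -scalemxAl mxE. Qed.

Lemma dotDr k (u v w : 'cV[R]_k) : dot w (u + v) = dot w u + dot w v.
Proof. by rewrite !(dotC w) dotDl. Qed.

Lemma dotNr k (u v : 'cV[R]_k) : dot v (- u) = - dot v u.
Proof. by rewrite !(dotC v) dotNl. Qed.

Lemma dotZr k a (u v : 'cV[R]_k) : dot v (a *: u) = a * dot v u.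
Proof. by rewrite !(dotC v) dotZl. Qed.

Lemma dot_mulmx p q (A : 'M[R]_(p, q)) u v : dot u (A *m v) = dot (A^T *m u) v.
Proof. by rewrite /dot trmx_mul trmxK mulmxA. Qed.

Lemma sqnormE k (v : 'cV[R]_k) : sqnorm v = dot v v.
Proof. by rewrite dotE; apply: eq_bigr => i _; rewrite expr2. Qed.

Lemma dot_ge0 k (v : 'cV[R]_k) : 0 <= dot v v.
Proof. by rewrite -sqnormE; apply: sumr_ge0 => i _; apply: sqr_ge0. Qed.

Lemma dot_eq0 k (v : 'cV[R]_k) : dot v v = 0 -> v = 0.
Proof.
rewrite -sqnormE => /eqP; rewrite psumr_eq0; last by move=> i _; apply: sqr_ge0.
move=> /allP v0; apply/matrixP => i j; rewrite ord1 mxE.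
by apply/eqP; rewrite -sqrf_eq0; apply: v0; rewrite mem_index_enum.
Qed.

Lemma dot_gt0 k (v : 'cV[R]_k) : v != 0 -> 0 < dot v v.
Proof.
by move=> v0; rewrite lt_def dot_ge0 andbT; apply: contra v0 => /eqP/dot_eq0 ->.
Qed.

End Dot.
Arguments dot {R k}.

Definition dot_linE := (@dotDl, @dotDr, @dotNl, @dotNr, @dotZl, @dotZr).

(** * Orthogonal diagonalization of real symmetric matrices *)

Section Spectral.
Set Implicit Arguments. Unset Strict Implicit.
Context {R : realType}.

(** Over the complex numbers the matrix is Hermitian, so it has a real eigenvalue. That value is a
    root of the real characteristic polynomial, hence has a real row eigenvector [u]; symmetry lets
    its transpose serve as a column eigenvector. *)
Lemma symmetric_eigenvector k (A : 'M[R]_k.+1) : A^T = A ->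
  exists (a : R) (v : 'cV[R]_k.+1), dot v v = 1 /\ A *m v = a *: v.
Proof.
move=> symA; pose AC : 'M[R[i]]_k.+1 := map_mx (real_complex R) A.
have hermAC : AC \is hermsymmx.
  apply: realsym_hermsym.
    by apply/is_hermitianmxP/matrixP => i j; rewrite expr0 scale1r !mxE -{1}symA mxE.
  by apply/mxOverP => i j; rewrite mxE; apply/complex_realP; exists (A i j).
have /orthomx_spectralP AE := hermitian_normalmx hermAC.
have /mxOverP/(_ 0 0)/complex_realP[a da] := hermitian_spectral_diag_real hermAC.
have Pu := spectral_unit AC.
move: (spectralmx AC) (spectral_diag AC) Pu AE da => P D Pu AE da.
have : root (char_poly AC) (D 0 0).
  rewrite -eigenvalue_root_char; apply/eigenvalueP; exists (row 0 P).
    rewrite AE -row_mul !mulmxA mulmxV// mul1mx.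
    by apply/rowP => j; rewrite mul_diag_mx !mxE.
  apply/eqP => /(congr1 (mulmx^~ (invmx P))).
  rewrite -row_mul mulmxV// mul0mx => /rowP/(_ 0) /eqP.
  by rewrite !mxE/= oner_eq0.
rewrite da -map_char_poly fmorph_root -eigenvalue_root_char.
move=> /eigenvalueP[u uA u0].
have vv : 0 < dot u^T u^T by apply: dot_gt0; rewrite trmx_eq0.
exists a, ((Num.sqrt (dot u^T u^T))^-1 *: u^T); split.
  rewrite dotZl dotZr mulrA -invfM -expr2 sqr_sqrtr ?dot_ge0//.
  by rewrite mulVf// gt_eqF.
rewrite -scalemxAr scalerA mulrC -scalerA; congr (_ *: _).
by rewrite -[A]symA -trmx_mul uA linearZ.
Qed.

(** The reflection across the hyperplane orthogonal to [v - w]; equal norms give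
    [dot u u = 2 * dot u v] for [u = v - w]. If [v = w] the identity serves. *)
Lemma householder k (v w : 'cV[R]_k) : dot v v = dot w w ->
  exists H : 'M[R]_k, [/\ H^T = H, H *m H = 1%:M & H *m v = w].
Proof.
move=> vw; have [->|ne] := eqVneq v w.
  by exists 1%:M; rewrite trmx1 !mul1mx.
pose u := v - w; have u0 : dot u u != 0.
  by rewrite gt_eqF// dot_gt0// subr_eq0.
exists (1%:M - (2 / dot u u) *: (u *m u^T)); split.
- by rewrite linearB/= trmx1 linearZ/= trmx_mul trmxK.
- rewrite mulmxBl mul1mx mulmxBr mulmx1 -scalemxAl -scalemxAr mulmxA.
  rewrite -(mulmxA u) [u^T *m u]mx11_scalar -/(dot u u) mul_mx_scalar.
  rewrite -scalemxAl !scalerA -scalerBl -addrA -opprD -scalerDl.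
  rewrite [X in X *: _](_ : _ = 0) ?scale0r ?subr0//; by field.
- rewrite mulmxBl mul1mx -scalemxAl -mulmxA [u^T *m v]mx11_scalar -/(dot u v).
  rewrite mul_mx_scalar scalerA.
  have -> : 2 / dot u u * dot u v = 1.
    have E : dot u u = 2 * dot u v.
      by rewrite /u !dot_linE (dotC w v) -vw; ring.
    by rewrite mulrAC -E divff.
  by rewrite scale1r /u opprB addrC subrK.
Qed.

(** Deflation: a reflection carries a unit eigenvector to the first basis vector [e]. The conjugate
    [B] then has first column [a *: e], by symmetry also such a first row, and the induction applies
    to its lower right block. *)
Lemma symmetric_diagonalization k (A : 'M[R]_k) : A^T = A ->
  exists (Q : 'M[R]_k) d, Q^T *m Q = 1%:M /\ A = Q^T *m diag_mx d *m Q.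
Proof.
elim: k A => [|k IH] A symA.
  by exists 0, 0; split; apply/matrixP => -[].
have [a [v [v1 Av]]] := symmetric_eigenvector symA.
pose e : 'cV[R]_(1 + k) := col_mx 1%:M 0.
have e1 : dot e e = 1.
  by rewrite /dot tr_col_mx mul_row_col trmx0 mul0mx addr0 trmx1 mul1mx mxE.
have [H [HT HH Hv]] : exists H : 'M[R]_(1 + k), [/\ H^T = H, H *m H = 1%:M & H *m v = e].
  by apply: householder; rewrite v1 e1.
pose B : 'M[R]_(1 + k) := H *m A *m H.
have symB : B^T = B by rewrite /B !trmx_mul HT symA mulmxA.
have Be : B *m e = a *: e.
  by rewrite /B -Hv -!mulmxA [H *m (H *m _)]mulmxA HH mul1mx Av -scalemxAr.
have AE : A = H *m B *m H by rewrite /B !mulmxA HH mul1mx -mulmxA HH mulmx1.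
have [ulE dlE] : ulsubmx B = a%:M /\ dlsubmx B = 0.
  move: Be; rewrite -[B in B *m _]submxK /e mul_block_col !mulmx0 !mulmx1 !addr0.
  by rewrite scale_col_mx scaler0 scale_scalar_mx mulr1 => /eq_col_mx.
have urE : ursubmx B = 0.
  by rewrite -[B]symB -trmx_dlsub dlE trmx0.
have symD : (drsubmx B)^T = drsubmx B by rewrite trmx_drsub symB.
have [Q [d [QQ DE]]] := IH _ symD.
pose Q1 : 'M[R]_(1 + k) := block_mx 1%:M 0 0 Q.
have Q1T : Q1^T = block_mx 1%:M 0 0 Q^T by rewrite /Q1 tr_block_mx !trmx0 trmx1.
have Q1Q : Q1^T *m Q1 = 1%:M.
  by rewrite Q1T mulmx_block !mulmx0 !mul0mx !mulmx1 !addr0 !add0r QQ -scalar_mx_block.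
have BE : B = Q1^T *m diag_mx (row_mx a%:M d) *m Q1.
  rewrite Q1T /Q1 diag_mx_row !mulmx_block.
  rewrite !(mulmx0, mul0mx, mulmx1, mul1mx, addr0, add0r) -DE.
  rewrite -[LHS]submxK ulE dlE urE; congr block_mx.
  by apply/matrixP => i j; rewrite !ord1 !mxE.
exists (Q1 *m H), (row_mx a%:M d); split.
  by rewrite trmx_mul HT -mulmxA [_ *m (_ *m H)]mulmxA Q1Q mul1mx HH.
by rewrite AE BE trmx_mul HT !mulmxA.
Qed.

End Spectral.

(** * Ordered eigenvalues, extremal quadratic forms and positive semidefinite matrices *)

Section Eig.
Set Implicit Arguments. Unset Strict Implicit.
Context {R : realType}.

Lemma char_poly_diagonalized k (Q : 'M[R]_k) d : Q^T *m Q = 1%:M ->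
  char_poly (Q^T *m diag_mx d *m Q) = \prod_i ('X - (d 0 i)%:P).
Proof.
move=> QQ; transitivity (char_poly (diag_mx d)); last first.
  rewrite char_poly_trig ?diag_mx_is_trig//.
  by apply: eq_bigr => i _; rewrite mxE eqxx.
have QQP : map_mx polyC Q^T *m map_mx polyC Q = 1%:M.
  by rewrite -map_mxM QQ map_mx1.
rewrite /char_poly (_ : char_poly_mx _ =
  map_mx polyC Q^T *m char_poly_mx (diag_mx d) *m map_mx polyC Q); last first.
  rewrite /char_poly_mx mulmxBr mulmxBl -!map_mxM; congr (_ - _).
  by rewrite mul_mx_scalar -scalemxAl QQP scalemx1.
by rewrite !det_mulmx mulrAC -det_mulmx QQP det1 mul1r.
Qed.

Lemma orthogonal_diagE k (Q : 'M[R]_k) d i j :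
  (Q^T *m diag_mx d *m Q) i j = \sum_l Q l i * d 0 l * Q l j.
Proof.
by rewrite mul_mx_diag mxE; apply: eq_bigr => l _; rewrite !mxE.
Qed.

Lemma spectrum_sorted k (A : 'M[R]_k) : sorted >=%R (spectrum A).
Proof. by rewrite /spectrum; case: pselect => //= h; case: (cid h) => s []. Qed.

(** [spectrum] is only some sorted list splitting the characteristic polynomial. Sorting the
    diagonal entries shows that such a list exists, and unique factorization makes it a permutation
    of them; permuting the rows of [Q] alike puts the eigenvalues in order. *)
Lemma spectral_eig k (A : 'M[R]_k) : A^T = A ->
  size (spectrum A) = k /\
  exists Q : 'M[R]_k,
    Q^T *m Q = 1%:M /\ A = Q^T *m diag_mx (\row_i eig A i) *m Q.
Proof.
move=> /symmetric_diagonalization[Q [d [QQ AE]]].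
pose t := [tuple d 0 i | i < k].
have charA : char_poly A = \prod_(x <- t) ('X - x%:P).
  by rewrite {1}AE char_poly_diagonalized// /t /= big_map big_enum.
have ex : exists s : seq R, sorted >=%R s /\ char_poly A = \prod_(x <- s) ('X - x%:P).
  exists (sort >=%R t); split; first by apply: sort_sorted => x y; apply: le_total.
  by rewrite charA; apply: perm_big; rewrite perm_sym perm_sort.
have : perm_eq (spectrum A) t.
  rewrite /spectrum; case: pselect => // h; case: (cid h) => s /= [_ sE].
  by apply: prod_XsubC_eq; rewrite -sE.
move=> /tuple_permP[p sE]; split; first by rewrite sE size_tuple.
have eE (i : 'I_k) : eig A i = d 0 (p i).
  by rewrite /eig sE -tnth_nth !tnth_mktuple.
exists (row_perm p Q); split.
  rewrite -QQ; apply/matrixP => i j; rewrite !mxE [RHS](reindex_inj (@perm_inj _ p)).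
  by apply: eq_bigr => l _; rewrite !mxE.
rewrite {1}AE; apply/matrixP => i j; rewrite !orthogonal_diagE.
rewrite (reindex_inj (@perm_inj _ p)).
by apply: eq_bigr => l _; rewrite !mxE eE.
Qed.

Lemma eig_le k (A : 'M[R]_k) i j : A^T = A -> (i <= j < k)%N -> eig A j <= eig A i.
Proof.
move=> /spectral_eig[sz _] /andP[ij jk].
apply: (sorted_leq_nth (fun _ _ _ h1 h2 => le_trans h2 h1) _ _ (spectrum_sorted A)) => //.
- by rewrite inE sz (leq_ltn_trans ij).
- by rewrite inE sz.
Qed.

Lemma lambda_minE k (A : 'M[R]_k) : A^T = A -> lambda_min A = eig A k.-1.
Proof. by move=> /spectral_eig[sz _]; rewrite /lambda_min -nth_last sz. Qed.

Lemma lambda_maxE k (A : 'M[R]_k) : lambda_max A = eig A 0.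
Proof. by rewrite /lambda_max -nth0. Qed.

Lemma dot_diag k (Q : 'M[R]_k) d z :
  dot z (Q^T *m diag_mx d *m Q *m z) = \sum_i d 0 i * ((Q *m z) i 0) ^+ 2.
Proof.
rewrite -!mulmxA dot_mulmx trmxK dotE; apply: eq_bigr => i _.
by move: (Q *m z) => w; rewrite mul_diag_mx mxE; ring.
Qed.

Lemma dot_orthogonal k (Q : 'M[R]_k) z : Q^T *m Q = 1%:M ->
  dot z z = \sum_i ((Q *m z) i 0) ^+ 2.
Proof.
move=> QQ; rewrite -[X in dot _ X]mul1mx -QQ -mulmxA dot_mulmx trmxK.
exact/esym/sqnormE.
Qed.

Lemma lambda_min_le k (A : 'M[R]_k) z : A^T = A ->
  lambda_min A * dot z z <= dot z (A *m z).
Proof.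
move=> symA; have [_ [Q [QQ AE]]] := spectral_eig symA.
rewrite [in X in _ <= X]AE dot_diag (dot_orthogonal _ QQ) mulr_sumr.
apply: ler_sum => i _; rewrite ler_wpM2r ?sqr_ge0// mxE lambda_minE//.
by apply: eig_le => //; case: k {A symA Q QQ AE z} i => [[]//|k] i /=;
  rewrite -ltnS ltn_ord ltnSn.
Qed.

Lemma lambda_max_ge k (A : 'M[R]_k) z : A^T = A ->
  dot z (A *m z) <= lambda_max A * dot z z.
Proof.
move=> symA; have [_ [Q [QQ AE]]] := spectral_eig symA.
rewrite [in X in X <= _]AE dot_diag (dot_orthogonal _ QQ) mulr_sumr.
apply: ler_sum => i _; rewrite ler_wpM2r ?sqr_ge0// mxE lambda_maxE//.
by apply: eig_le => /=.
Qed.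

(** The vector is row [i] of [Q], transposed. It turns bounds on the quadratic form into bounds on
    individual eigenvalues. *)
Lemma eig_attained k (A : 'M[R]_k) (i : 'I_k) : A^T = A ->
  exists z, dot z z = 1 /\ dot z (A *m z) = eig A i.
Proof.
move=> symA; have [_ [Q [QQ AE]]] := spectral_eig symA.
have QzE : Q *m (Q^T *m delta_mx i 0) = delta_mx i 0 :> 'cV[R]_k.
  by rewrite mulmxA (mulmx1C QQ) mul1mx.
exists (Q^T *m delta_mx i 0); split.
  rewrite (dot_orthogonal _ QQ) QzE (bigD1 i)//= big1 ?addr0.
    by rewrite mxE !eqxx expr1n.
  by move=> j ji; rewrite mxE (negPf ji) expr0n.
rewrite [in X in X = _]AE dot_diag QzE (bigD1 i)//= big1 ?addr0.
  by rewrite !mxE !eqxx expr1n mulr1.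
by move=> j ji; rewrite !mxE (negPf ji) expr0n mulr0.
Qed.

Lemma lambda_min_ge k (A : 'M[R]_k) c : (0 < k)%N -> A^T = A ->
  (forall z, c * dot z z <= dot z (A *m z)) -> c <= lambda_min A.
Proof.
case: k A => // k A _ symA cA; have [z [z1 zE]] := eig_attained ord_max symA.
by rewrite lambda_minE//= -zE; have := cA z; rewrite z1 mulr1.
Qed.

(** Symmetry is built in because a real quadratic form sees only the symmetric part of its matrix,
    while the factorization below rests on the spectral theorem. *)
Definition psd k (A : 'M[R]_k) := A^T = A /\ forall z, 0 <= dot z (A *m z).

Lemma psd_gram p q (S : 'M[R]_(p, q)) : psd (S^T *m S).
Proof.
split; first by rewrite trmx_mul trmxK.
by move=> z; rewrite -mulmxA dot_mulmx trmxK dot_ge0.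
Qed.

Lemma psd_factor k (A : 'M[R]_k) : psd A -> exists S : 'M[R]_k, A = S^T *m S.
Proof.
move=> [symA A0]; have [_ [Q [QQ AE]]] := spectral_eig symA.
have e0 i : (i < k)%N -> 0 <= eig A i.
  by move=> ik; have [z [_ <-]] := eig_attained (Ordinal ik) symA.
exists (diag_mx (\row_i Num.sqrt (eig A i)) *m Q).
rewrite trmx_mul tr_diag_mx mulmxA -(mulmxA Q^T) mulmx_diag {1}AE.
congr (_ *m diag_mx _ *m _); apply/rowP => i; rewrite !mxE -expr2 sqr_sqrtr//.
exact: e0.
Qed.

(** A factorization [S^T *m S] tensors to the Gram matrix of [S *t 1%:M]. *)
Lemma psd_tens1 k n (A : 'M[R]_k) : psd A -> psd (A *t (1%:M : 'M[R]_n)).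
Proof.
move=> /psd_factor[S ->].
rewrite -[X in _ *t X](mulmx1 1%:M) -tensmx_mul -[X in _ *t X *m _]trmx1 -trmx_tens.
exact: psd_gram.
Qed.

(** With [B = S^T *m S], cyclicity turns the trace into that of [S *m A *m S^T], a sum of values of
    the form [A] at the rows of [S]. *)
Lemma psd_trace k (A B : 'M[R]_k) : psd A -> psd B -> 0 <= \tr (A *m B).
Proof.
move=> [_ A0] /psd_factor[S ->]; rewrite mulmxA mxtrace_mulC.
apply: sumr_ge0 => i _; have := A0 (row i S)^T.
rewrite /dot trmxK [in X in _ -> X]mxE mxE; under eq_bigr do rewrite !mxE.
by under [X in _ -> _ <= X]eq_bigr do rewrite mxE; congr (0 <= _);
  apply: eq_bigr => j _; congr (_ * _); apply: eq_bigr => l _; rewrite !mxE.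
Qed.

End Eig.

(** * Spectral gap of the graph Laplacian *)

Section Gap.
Set Implicit Arguments. Unset Strict Implicit.
Context {R : realType}.

(** In an eigenbasis the kernel vector [e] has only its last coordinate nonzero, since all earlier
    eigenvalues are positive. The bracket is [dot e e] times the squared distance from [z] to the
    line of [e]; multiplying through by [dot e e] avoids division. *)
Lemma spectral_gap k (L : 'M[R]_k.+1) (e : 'cV[R]_k.+1) b : psd L -> L *m e = 0 ->
  0 < b -> (forall i, (i < k)%N -> b <= eig L i) ->
  forall z, b * (dot z z * dot e e - dot e z ^+ 2) <= dot z (L *m z) * dot e e.
Proof.
move=> [symL L0] Le b0 gap z; have [_ [Q [QQ LE]]] := spectral_eig symL.
have last_ge0 : 0 <= eig L k.
  by have [x [_ <-]] := eig_attained (@ord_max k) symL.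
have oE (i : 'I_k.+1) : eig L i * (Q *m e) i 0 = 0.
  have : Q *m (L *m e) = 0 by rewrite Le mulmx0.
  rewrite {1}LE !mulmxA (mulmx1C QQ) mul1mx -mulmxA => /matrixP/(_ i 0).
  by rewrite mul_diag_mx !mxE.
have o0 (i : 'I_k.+1) : i != ord_max -> (Q *m e) i 0 = 0.
  move=> iM; have/eqP := oE i; rewrite mulf_eq0 => /orP[/eqP ei|/eqP//].
  suff /gap : (i < k)%N by rewrite leNgt ei b0.
  by rewrite ltn_neqAle -ltnS ltn_ord andbT; move: iM; rewrite -val_eqE.
set y := Q *m z; set o := Q *m e in o0 *.
have eeE : dot e e = o ord_max 0 ^+ 2.
  rewrite (dot_orthogonal _ QQ) (bigD1 ord_max)//= big1 ?addr0// => i iM.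
  by rewrite -/o o0// expr0n.
have ezE : dot e z = o ord_max 0 * y ord_max 0.
  rewrite -[z]mul1mx -QQ -mulmxA dot_mulmx trmxK -/o -/y dotE.
  rewrite (bigD1 ord_max)//= big1 ?addr0// => i iM.
  by rewrite o0// mul0r.
have zzE : dot z z = y ord_max 0 ^+ 2 + \sum_(i | i != ord_max) y i 0 ^+ 2.
  by rewrite (dot_orthogonal _ QQ) (bigD1 ord_max).
have zLzE : dot z (L *m z) = eig L k * y ord_max 0 ^+ 2 +
    \sum_(i | i != ord_max) eig L i * y i 0 ^+ 2.
  rewrite {1}LE dot_diag (bigD1 ord_max)//= mxE; congr (_ + _).
  by apply: eq_bigr => i _; rewrite mxE.
have : b * \sum_(i | i != ord_max) y i 0 ^+ 2 <=
    \sum_(i | i != ord_max) eig L i * y i 0 ^+ 2.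
  rewrite mulr_sumr; apply: ler_sum => i iM; rewrite ler_wpM2r ?sqr_ge0//.
  by apply: gap; rewrite ltn_neqAle -ltnS ltn_ord andbT; move: iM; rewrite -val_eqE.
rewrite zLzE zzE ezE eeE => h.
have -> : b * ((y ord_max 0 ^+ 2 + \sum_(i | i != ord_max) y i 0 ^+ 2) * o ord_max 0 ^+ 2 -
  (o ord_max 0 * y ord_max 0) ^+ 2) =
  (b * \sum_(i | i != ord_max) y i 0 ^+ 2) * o ord_max 0 ^+ 2 by ring.
rewrite ler_wpM2r ?sqr_ge0//; apply: le_trans h _.
by rewrite lerDr mulr_ge0 ?sqr_ge0.
Qed.

(** Each row holds one [1] and one [-1]. Distinct endpoints matter: [incidence] tests the source
    first, so a loop would leave a lone [1]. *)
Lemma incidence_const E T (src dst : 'I_E -> 'I_T) :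
  (forall e, src e != dst e) ->
  incidence R src dst *m (const_mx 1 : 'cV[R]_T) = 0.
Proof.
move=> ne; apply/matrixP => e j; rewrite !mxE (bigD1 (src e))//= (bigD1 (dst e)) 1?eq_sym//=.
rewrite big1 ?addr0; last first.
  by move=> i /andP[/negPf is_ /negPf id_]; rewrite !mxE is_ id_ mul0r.
by rewrite !mxE !eqxx eq_sym (negPf (ne e)) !mulr1 subrr.
Qed.

Lemma dot_const T (z : 'cV[R]_T) : dot (const_mx 1) z = \sum_i z i 0.
Proof. by rewrite dotE; apply: eq_bigr => i _; rewrite mxE mul1r. Qed.

(** The subtracted matrix is [b] times the orthogonal projection away from the constant vectors. As
    an inequality between matrices, the gap can be tensored with the identity. *)
Lemma psd_laplacian_gap E T (src dst : 'I_E -> 'I_T) b : (2 <= T)%N ->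
  (forall e, src e != dst e) -> 0 < b ->
  let L := (incidence R src dst)^T *m incidence R src dst in
  b <= eig L (T - 2) ->
  psd (L - b *: (1%:M - T%:R^-1 *: (const_mx 1 : 'M[R]_T))).
Proof.
case: T src dst => [//|[//|k]] src dst _ ne b0 L.
rewrite subn2 /= => gap; have psdL : psd L := psd_gram _.
have symL := psdL.1; split.
  rewrite !(linearB, linearZ)/= symL trmx1; do 4 f_equal.
  by rewrite trmx_const.
move=> z; pose e : 'cV[R]_k.+2 := const_mx 1.
have Le : L *m e = 0 by rewrite /L -mulmxA incidence_const// mulmx0.
(* With eigenvalues numbered from [0] and [T = k.+2], the index [T - 2 = k] is that of the second
   smallest one, so the order extends the bound to all but the last. *)
have gap' i : (i < k.+1)%N -> b <= eig L i.
  by move=> ik; apply: le_trans gap _; apply: eig_le => //; rewrite -ltnS ik/=.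
have := spectral_gap psdL Le b0 gap' z.
have eeE : dot e e = k.+2%:R.
  by rewrite dot_const (eq_bigr (fun=> 1)) ?sumr_const ?card_ord// => i _; rewrite mxE.
have eeT : (const_mx 1 : 'M[R]_k.+2) = e *m e^T.
  by apply/matrixP => i j; rewrite !mxE big_ord1 !mxE mulr1.
rewrite eeT mulmxBl -scalemxAl mulmxBl mul1mx -scalemxAl -(mulmxA e).
rewrite !dot_linE [e^T *m z]mx11_scalar -/(dot e z) mul_mx_scalar dotZr (dotC z e) eeE.
have k0 : (0 : R) < k.+2%:R by rewrite ltr0n.
rewrite -(ler_pM2r k0 0) mul0r -subr_ge0 => h; apply: le_trans h _.
by rewrite le_eqVlt; apply/orP; left; apply/eqP; field; rewrite gt_eqF.
Qed.

End Gap.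

(** * Vectors with equal blocks and the Kronecker indexing *)

Section Blocks.
Set Implicit Arguments. Unset Strict Implicit.
Context {R : realType} (T n : nat).

(** This is the Kronecker product of the all-ones column with the identity, given entrywise so that
    its columns are indexed by [n] and not by [1 * n]. *)
Definition repeat_mx : 'M[R]_(T * n, n) :=
  \matrix_(i, j) ((mxtens_unindex i).2 == j)%:R.

Lemma sum_mxtens (V : nmodType) (F : 'I_(T * n) -> V) :
  \sum_i F i = \sum_t \sum_j F (mxtens_index (t, j)).
Proof.
rewrite pair_big/= (reindex (@mxtens_index T n))/=.
  by apply: eq_bigr => -[].
by exists (@mxtens_unindex T n) => i _; rewrite (mxtens_indexK, mxtens_unindexK).
Qed.

Lemma trmx_mul_repeat : repeat_mx^T *m repeat_mx = T%:R%:M.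
Proof.
apply/matrixP => i j; rewrite mxE sum_mxtens !mxE.
rewrite (eq_bigr (fun=> (i == j)%:R)).
  by rewrite sumr_const card_ord; case: (i == j); rewrite ?mul0rn.
move=> t _; rewrite (bigD1 i)//= big1 ?addr0.
  by rewrite !mxE mxtens_indexK/= eqxx mul1r.
by move=> l li; rewrite !mxE mxtens_indexK/= (negPf li) mul0r.
Qed.

Lemma mul_repeat_trmx :
  repeat_mx *m repeat_mx^T = (const_mx 1 : 'M[R]_T) *t 1%:M.
Proof.
apply/matrixP => i j; rewrite !mxE (bigD1 (mxtens_unindex i).2)//= big1 ?addr0.
  by rewrite !mxE eqxx !mul1r eq_sym.
by move=> l li; rewrite !mxE eq_sym (negPf li) mul0r.
Qed.

(** This is the bridge between the dependent block indexing of [mxblock] and the Kronecker indexing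
    of [repeat_mx]. *)
Lemma blockdiag_repeat (m : 'I_T -> nat) (Ct : forall t, 'M[R]_(m t, n)) :
  blockdiag Ct *m repeat_mx = obsmx Ct.
Proof.
have -> : repeat_mx = castmx (sum_const_n T n, erefl) (\mxcol_(t < T) (1%:M : 'M[R]_n)).
  apply/matrixP => i j; rewrite castmxE/= cast_ord_id !mxE; congr (_%:R).
  (* As all blocks have size [n], [tagnat] reads the index as [t * n + r]; its residue modulo [n] is
     then [r], which is the second Kronecker coordinate. *)
  set s := cast_ord _ i; have : s = i :> nat by [].
  rewrite {1}(tagnat.rect s) sum_nat_cond_const => iE.
  congr (nat_of_bool _); rewrite -!val_eqE/=; congr (_ == _).
  by rewrite -iE modnMDl modn_small.
rewrite /blockdiag mulmx_cast castmx_comp/= !castmx_id.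
rewrite mul_mxblock_mxrow /obsmx; apply: eq_mxcol => i.
rewrite (bigD1 i)//= big1 ?addr0; first by rewrite eqxx mulmx1.
by move=> j ji; rewrite eq_sym (negPf ji) mul0mx.
Qed.

End Blocks.

(** * The scalar bound [lbar'] and the binary quadratic form behind it *)

Section Lbar.
Set Implicit Arguments. Unset Strict Implicit.
Context {R : realType}.
Context (b1 b2 b3 mu : R).
Context (b1_gt0 : 0 < b1) (b2_gt0 : 0 < b2) (b3_gt0 : 0 < b3) (mu_gt0 : 0 < mu).

Let a := mu * b1.
Let q := Num.sqrt (b3 ^+ 2 + (a - b2) ^+ 2).

Let a_gt0 : 0 < a. Proof. exact: mulr_gt0. Qed.

Lemma lbar_threshold :
  (a < b2 + (b3 ^+ 2 - b2 ^+ 2) / (2 * b2)) = (2 * a * b2 < b2 ^+ 2 + b3 ^+ 2).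
Proof.
have -> : b2 + (b3 ^+ 2 - b2 ^+ 2) / (2 * b2) = (b2 ^+ 2 + b3 ^+ 2) / (2 * b2).
  by field; rewrite gt_eqF.
by rewrite ltr_pdivlMr ?mulr_gt0// mulrCA mulrA.
Qed.

(* The second branch is half the smallest eigenvalue of [[b2, -b3/2], [-b3/2, a]]. *)
Lemma lbar'E : lbar' b1 b2 b3 mu =
  if 2 * a * b2 < b2 ^+ 2 + b3 ^+ 2 then b2 ^+ 2 / (2 * (b2 ^+ 2 + b3 ^+ 2)) * a
  else (a + b2 - q) / 4.
Proof.
rewrite /lbar' -/a lbar_threshold; case: ifP => // _; rewrite -/q.
have q0 : 0 < q by rewrite sqrtr_gt0 ltr_pwDl ?exprn_gt0// sqr_ge0.
have qq : q ^+ 2 = b3 ^+ 2 + (a - b2) ^+ 2.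
  by rewrite sqr_sqrtr// addr_ge0 ?sqr_ge0.
have -> : b2 * (a - b2) - b3 ^+ 2 = a * (a - b2) - q ^+ 2 by rewrite qq; ring.
by field; rewrite gt_eqF.
Qed.

(** In the second branch positivity means [q < a + b2], that is [b3 ^+ 2 < 4 * a * b2], which the
    branch condition implies. *)
Lemma lbar'_gt0 : 0 < lbar' b1 b2 b3 mu.
Proof.
rewrite lbar'E; case: (ltP (2 * a * b2)) => h.
  by rewrite mulr_gt0 ?divr_gt0 ?mulr_gt0 ?addr_gt0 ?exprn_gt0.
rewrite divr_gt0// subr_gt0 -(ltr_pXn2r (n := 2)) ?nnegrE ?sqrtr_ge0 ?addr_ge0 ?ltW//.
rewrite sqr_sqrtr ?addr_ge0 ?sqr_ge0//.
have := exprn_gt0 2 b2_gt0; have := exprn_gt0 2 b3_gt0; rewrite !expr2 in h *; nra.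
Qed.

(** The hypothesis excludes the first branch. In the second the claim is [q <= a], which after
    squaring reads [b2 ^+ 2 + b3 ^+ 2 <= 2 * a * b2]. *)
Lemma lbar'_ge : b2 + b3 ^+ 2 / b2 <= a -> b2 / 4 <= lbar' b1 b2 b3 mu.
Proof.
have -> : b2 + b3 ^+ 2 / b2 = (b2 ^+ 2 + b3 ^+ 2) / b2 by field; rewrite gt_eqF.
rewrite ler_pdivrMr// => h.
rewrite lbar'E; case: (ltP (2 * a * b2)) => h'; first by nra.
rewrite ler_pM2r ?invr_gt0// lerBrDr addrC lerD2r.
rewrite -(ler_pXn2r (n := 2)) ?nnegrE ?sqrtr_ge0 ?ltW//.
rewrite sqr_sqrtr ?addr_ge0 ?sqr_ge0//.
have := exprn_gt0 2 b2_gt0; have := exprn_gt0 2 b3_gt0.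
have := mulr_gt0 a_gt0 b2_gt0; rewrite !expr2 in h *; nra.
Qed.

(** Here [p] and [r] stand for [|u|] and [|v|], and [X] for [|C z|^2]. In both branches the
    inequality is proved with twice [lbar'] on the left. *)
Lemma lbar'_quadratic (p r X : R) : 0 <= p -> 0 <= r -> 0 <= X ->
  b2 * p ^+ 2 - b3 * p * r <= X ->
  lbar' b1 b2 b3 mu * (p ^+ 2 + r ^+ 2) <= a * r ^+ 2 + X.
Proof.
move=> p0 r0 X0 hX; rewrite lbar'E; case: (ltP (2 * a * b2)) => h; last first.
  have q0 : 0 <= q by rewrite sqrtr_ge0.
  have qq : q ^+ 2 = b3 ^+ 2 + (a - b2) ^+ 2.
    by rewrite sqr_sqrtr// addr_ge0 ?sqr_ge0.
  have dq : 0 < q by rewrite sqrtr_gt0 ltr_pwDl ?exprn_gt0// sqr_ge0.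
  have q1 : q <= a + b2.
    rewrite -(ler_pXn2r (n := 2)) ?nnegrE ?addr_ge0 ?ltW// qq.
    have := exprn_gt0 2 b2_gt0; have := mulr_gt0 a_gt0 b2_gt0; rewrite !expr2 in h *; nra.
  have : (a + b2 - q) / 2 * (p ^+ 2 + r ^+ 2) <= a * r ^+ 2 + (b2 * p ^+ 2 - b3 * p * r).
    (* the form minus its smallest eigenvalue is a square up to the factor q + a - b2 *)
    have qab : 0 < q + (a - b2).
      have : q ^+ 2 > (a - b2) ^+ 2 by rewrite qq ltrDr exprn_gt0.
      by rewrite -ltr_sqrt ?exprn_gt0 // !sqrtr_sqr (ger0_norm q0) => /ltr_normlP[]; lra.
    rewrite -subr_ge0 -(pmulr_rge0 _ qab).
    have -> : (q + (a - b2)) * (a * r ^+ 2 + (b2 * p ^+ 2 - b3 * p * r) -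
        (a + b2 - q) / 2 * (p ^+ 2 + r ^+ 2)) =
      ((q + (a - b2)) * r - b3 * p) ^+ 2 / 2 +
        (q ^+ 2 - b3 ^+ 2 - (a - b2) ^+ 2) * p ^+ 2 / 2.
      by field.
    by rewrite qq [X in X * p ^+ 2](_ : _ = 0) ?mul0r ?addr0 ?divr_ge0 ?sqr_ge0//; ring.
  have : 0 <= (a + b2 - q) * (p ^+ 2 + r ^+ 2) by rewrite mulr_ge0 ?subr_ge0 ?addr_ge0 ?sqr_ge0.
  lra.
have s0 : 0 < b2 ^+ 2 + b3 ^+ 2 by rewrite addr_gt0 ?exprn_gt0.
pose k := a / (b2 ^+ 2 + b3 ^+ 2).
have kE : a = k * (b2 ^+ 2 + b3 ^+ 2) by rewrite /k divfK ?gt_eqF.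
have k0 : 0 < k by rewrite divr_gt0.
have -> : b2 ^+ 2 / (2 * (b2 ^+ 2 + b3 ^+ 2)) * a = k * b2 ^+ 2 / 2.
  by rewrite /k; field; rewrite gt_eqF.
have k2 : 2 * (k * b2) < 1.
  move: h; rewrite kE -subr_gt0.
  have -> : b2 ^+ 2 + b3 ^+ 2 - 2 * (k * (b2 ^+ 2 + b3 ^+ 2)) * b2 =
    (b2 ^+ 2 + b3 ^+ 2) * (1 - 2 * (k * b2)) by ring.
  by rewrite pmulr_rgt0// subr_gt0.
have kb0 : 0 <= k * b2 ^+ 2 * (p ^+ 2 + r ^+ 2).
  by rewrite mulr_ge0 ?addr_ge0 ?sqr_ge0// mulr_ge0 ?sqr_ge0// ltW.
suff : k * b2 ^+ 2 * (p ^+ 2 + r ^+ 2) <= a * r ^+ 2 + X by lra.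
(* If [b2 * p <= b3 * r], then [0 <= X] is enough. Otherwise the lower bound on [X] is used, and the
   remaining difference is exactly the product below; its second factor is nonnegative because
   [2 * (k * b2) < 1]. *)
have [rp|rp] := leP (b2 * p) (b3 * r).
  have : b2 ^+ 2 * p ^+ 2 <= b3 ^+ 2 * r ^+ 2.
    by rewrite -!exprMn ler_pXn2r ?nnegrE ?mulr_ge0//; apply: ltW.
  by move=> /(ler_wpM2l (ltW k0)); rewrite kE; nra.
have : 0 <= (b2 * p - b3 * r) * (p * (1 - k * b2) - r * (k * b3)).
  apply: mulr_ge0; first by rewrite subr_ge0 ltW.
  have : k * (b3 * r) <= k * (b2 * p) by rewrite ler_pM2l// ltW.
  have : 2 * (k * b2) * p <= p by rewrite ler_piMl// ltW.
  nra.
by rewrite kE; nra.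
Qed.

End Lbar.

(** * Cauchy-Schwarz and the spectral norm *)

Section Norms.
Set Implicit Arguments. Unset Strict Implicit.
Context {R : realType}.

Lemma dot_sqr_le k (u v : 'cV[R]_k) : dot u v ^+ 2 <= dot u u * dot v v.
Proof.
have [->|v0] := eqVneq v 0; first by rewrite /dot !mulmx0 mxE expr0n mulr0.
have vv := dot_gt0 v0.
have := dot_ge0 (dot v v *: u - dot u v *: v).
rewrite !dot_linE (dotC v u) => h; rewrite -subr_ge0 -(pmulr_rge0 _ vv).
by apply: le_trans h _; rewrite le_eqVlt; apply/orP; left; apply/eqP; ring.
Qed.

Lemma dot_le k (u v : 'cV[R]_k) x y : 0 <= x -> 0 <= y ->
  dot u u <= x ^+ 2 -> dot v v <= y ^+ 2 -> `|dot u v| <= x * y.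
Proof.
move=> x0 y0 ux vy; rewrite -(ler_pXn2r (n := 2)) ?nnegrE ?mulr_ge0//.
rewrite -normrX ger0_norm ?sqr_ge0// exprMn (le_trans (dot_sqr_le _ _))//.
by rewrite ler_pM ?dot_ge0.
Qed.

Lemma specnorm_ge0 p q (A : 'M[R]_(p, q)) : 0 <= specnorm A.
Proof. exact: sqrtr_ge0. Qed.

Lemma specnorm_le p q (A : 'M[R]_(p, q)) v :
  dot (A *m v) (A *m v) <= specnorm A ^+ 2 * dot v v.
Proof.
rewrite dot_mulmx mulmxA dotC; apply: le_trans (lambda_max_ge _ _) _.
  by rewrite trmx_mul trmxK.
rewrite ler_wpM2r ?dot_ge0// /specnorm.
(* Splitting on the sign avoids proving that this eigenvalue is nonnegative: a negative one lies
   below any square. *)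
have [h|h] := leP 0 (lambda_max (A^T *m A)); first by rewrite sqr_sqrtr.
by rewrite (le_trans (ltW h)) ?sqr_ge0.
Qed.

Lemma dotD_le k (u v : 'cV[R]_k) :
  dot (u - v) (u - v) <= 2 * dot u u + 2 * dot v v.
Proof.
have := dot_ge0 (u + v); rewrite !dot_linE; lra.
Qed.

End Norms.

(** * Loewner order, inverses and traces *)

Section LoewnerOrder.
Set Implicit Arguments. Unset Strict Implicit.
Context {R : realType}.

Lemma pos_def_unitmx k (A : 'M[R]_k) c : 0 < c ->
  (forall z, c * dot z z <= dot z (A *m z)) -> A \in unitmx.
Proof.
move=> c0 cA; rewrite -unitmx_tr -row_free_unit; apply/inj_row_free => v vA.
apply: trmx_inj; rewrite trmx0; apply: dot_eq0; apply/eqP.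
rewrite eq_le dot_ge0 andbT -(pmulr_rle0 _ c0) (le_trans (cA _))//.
by rewrite -[A]trmxK -trmx_mul vA trmx0 /dot mulmx0 mxE.
Qed.

Lemma psd_inv k (A A' : 'M[R]_k) : psd A -> A'^T = A' -> A *m A' = 1%:M -> psd A'.
Proof.
move=> [_ A0] symA' AA'; split=> // z; rewrite -[z in dot z]mul1mx -AA'.
by rewrite -mulmxA dotC; apply: A0.
Qed.

(** With [w = A' *m z] and [u = B' *m z], the form [B] at [w - u] plus the form [A - B] at [w]
    equals [dot u z - dot w z]. *)
Lemma inv_antitone k (A A' B B' : 'M[R]_k) :
  A'^T = A' -> B'^T = B' -> A *m A' = 1%:M -> B *m B' = 1%:M ->
  psd B -> psd (A - B) -> psd (B' - A').
Proof.
move=> symA' symB' AA' BB' [symB B0] [_ AB].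
split; first by rewrite linearB/= symA' symB'.
move=> z; rewrite mulmxBl dotDr dotNr.
pose w := A' *m z; pose u := B' *m z.
have Aw : A *m w = z by rewrite mulmxA AA' mul1mx.
have Bu : B *m u = z by rewrite mulmxA BB' mul1mx.
have uBw : dot u (B *m w) = dot w z by rewrite dot_mulmx symB Bu dotC.
have := B0 (w - u); have := AB w.
rewrite mulmxBl mulmxBr !dot_linE Aw Bu uBw -/w -/u (dotC u z) (dotC w z); lra.
Qed.

(** Squaring is not monotone for the Loewner order, but its trace is: the difference is a sum of two
    traces of products of positive semidefinite matrices. *)
Lemma trace_sqr_le k (A B : 'M[R]_k) : psd A -> psd B -> psd (B - A) ->
  \tr (A *m A) <= \tr (B *m B).
Proof.
move=> psdA psdB psdBA; rewrite -subr_ge0.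
have -> : \tr (B *m B) - \tr (A *m A) = \tr (B *m (B - A)) + \tr ((B - A) *m A).
  by rewrite mulmxBr mulmxBl !linearB/=; ring.
by rewrite addr_ge0// psd_trace.
Qed.

(** By cyclicity the trace is that of [N *m N] against [C^T *m C], which is below [specnorm C ^+ 2]
    times the identity. *)
Lemma mxtrace_gram_le p q (N : 'M[R]_p) (C : 'M[R]_(q, p)) : N^T = N ->
  \tr ((N *m C^T) *m (N *m C^T)^T) <= specnorm C ^+ 2 * \tr (N *m N).
Proof.
move=> symN; rewrite trmx_mul trmxK symN.
have -> : \tr (N *m C^T *m (C *m N)) = \tr (N *m N *m (C^T *m C)).
  by rewrite -mulmxA mxtrace_mulC [RHS]mxtrace_mulC !mulmxA.
rewrite -subr_ge0 -mxtraceZ -linearB/= -mul_mx_scalar -mulmxBr.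
apply: psd_trace; first by rewrite -{1}symN; apply: psd_gram.
split; first by rewrite linearB/= tr_scalar_mx trmx_mul trmxK.
move=> z; rewrite mulmxBl mul_scalar_mx dotDr dotNr dotZr subr_ge0.
by rewrite -mulmxA dot_mulmx trmxK specnorm_le.
Qed.

Lemma mxtrace_tens1 k n (A : 'M[R]_k) : \tr (A *t (1%:M : 'M[R]_n)) = n%:R * \tr A.
Proof.
rewrite /mxtrace sum_mxtens mulr_sumr; apply: eq_bigr => t _.
rewrite (eq_bigr (fun=> A t t)) ?sumr_const ?card_ord ?mulr_natl// => j _.
by rewrite tensmxE mxE eqxx mulr1.
Qed.

Lemma tensmx1D k n (A B : 'M[R]_k) :
  (A + B) *t (1%:M : 'M[R]_n) = A *t 1%:M + B *t 1%:M.
Proof. by apply/matrixP => i j; rewrite !mxE mulrDl. Qed.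

Lemma tensmx1Z k n a (A : 'M[R]_k) :
  (a *: A) *t (1%:M : 'M[R]_n) = a *: (A *t 1%:M).
Proof. by apply/matrixP => i j; rewrite !mxE mulrA. Qed.

Lemma tens_scalar1 k n a :
  (a%:M : 'M[R]_k) *t (1%:M : 'M[R]_n) = a%:M.
Proof.
apply/matrixP => i j; rewrite !mxE.
rewrite -(inj_eq (can_inj (@mxtens_unindexK k n)) i j) !xpair_eqE/= -!val_eqE.
by do 2 case: eqP => _ //=; rewrite ?mulr1 ?mulr0 ?mul0r.
Qed.

Lemma trace_inv_sqr_le k n (L : 'M[R]_k) (A A' : 'M[R]_(k * n)) lb mu :
  psd L -> 0 < lb -> 0 <= mu -> A^T = A -> A'^T = A' -> A *m A' = 1%:M ->
  (forall z, lb * dot z z <= dot z (A *m z)) ->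
  (forall z, mu * dot z (L *t (1%:M : 'M[R]_n) *m z) <= dot z (A *m z)) ->
  \tr (A' *m A') <= 4 * (n%:R * \sum_(i < k) 1 / (lb + mu * eig L i) ^+ 2).
Proof.
move=> [symL L0] lb0 mu0 symA symA' AA' Alb Amu.
have [_ [Q [QQ LE]]] := spectral_eig symL.
have e0 (i : 'I_k) : 0 < lb + mu * eig L i.
  rewrite ltr_wpDr// mulr_ge0//; have [z [_ <-]] := eig_attained i symL.
  exact: L0.
(* [D f] is the function [f] applied to the matrix [lb + mu L]: products, inverses and traces are
   computed on the eigenvalues. *)
pose D (f : R -> R) := Q^T *m diag_mx (\row_i f (lb + mu * eig L i)) *m Q.
have DM f g : D f *m D g = D (fun x => f x * g x).
  rewrite /D -!mulmxA [Q *m (_ *m _)]mulmxA (mulmx1C QQ) mul1mx.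
  rewrite [diag_mx _ *m (_ *m _)]mulmxA mulmx_diag.
  congr (Q^T *m (diag_mx _ *m Q)). by apply/matrixP => i j; rewrite !mxE.
have symD f : (D f)^T = D f by rewrite /D !trmx_mul trmxK tr_diag_mx mulmxA.
have DI : D id = lb%:M + mu *: L.
  have dE : \row_(i < k) (lb + mu * eig L i) = const_mx lb + mu *: (\row_i eig L i).
    by apply/rowP => i; rewrite !mxE.
  rewrite /= /D dE linearD/= linearZ/= diag_const_mx mulmxDr mulmxDl -scalemxAr -scalemxAl -LE.
  by rewrite mul_mx_scalar -scalemxAl QQ scalemx1.
have Dinv : D id *m D (fun x => x^-1) = 1%:M.
  rewrite DM; transitivity (Q^T *m 1%:M *m Q); last by rewrite mulmx1.
  congr (_ *m _ *m _).
  by apply/matrixP => i j; rewrite !mxE /= mulfV// gt_eqF ?e0. 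
have trD f : \tr (D f) = \sum_(i < k) f (lb + mu * eig L i).
  rewrite /D mxtrace_mulC mulmxA (mulmx1C QQ) mul1mx mxtrace_diag.
  by apply: eq_bigr => i _; rewrite mxE.
(* Averaging the two lower bounds on [A] gives [B]; the factor [2] of its inverse is squared into
   the constant [4]. *)
pose B := 2^-1 *: (D id *t (1%:M : 'M[R]_n)).
pose B' := 2 *: (D (fun x => x^-1) *t (1%:M : 'M[R]_n)).
have symB : B^T = B by rewrite linearZ/= trmx_tens symD trmx1.
have symB' : B'^T = B' by rewrite linearZ/= trmx_tens symD trmx1.
have BB' : B *m B' = 1%:M.
  rewrite -scalemxAl -scalemxAr scalerA mulVf ?scale1r// tensmx_mul Dinv mulmx1.
  exact: tens_scalar1.
have psdLn : psd (L *t (1%:M : 'M[R]_n)) by apply: psd_tens1.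
have BE z : dot z (B *m z) = (lb * dot z z + mu * dot z (L *t (1%:M : 'M[R]_n) *m z)) / 2.
  rewrite /B DI tensmx1D tensmx1Z tens_scalar1 -scalemxAl mulmxDl mul_scalar_mx.
  by rewrite -scalemxAl !dot_linE mulrC.
have psdB : psd B.
  by split=> // z; rewrite BE divr_ge0// addr_ge0// mulr_ge0 ?dot_ge0 ?psdLn.2// ltW.
have psdAB : psd (A - B).
  split; first by rewrite linearB/= symA symB.
  move=> z; rewrite mulmxBl dotDr dotNr BE.
  have := Alb z; have := Amu z; lra.
have psdA : psd A.
  by split=> // z; apply: le_trans (Alb z); rewrite mulr_ge0 ?dot_ge0// ltW.
apply: le_trans (trace_sqr_le (psd_inv psdA symA' AA') (psd_inv psdB symB' BB') _) _.
  exact: inv_antitone AA' BB' psdB psdAB.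
rewrite -scalemxAl -scalemxAr scalerA linearZ/= tensmx_mul DM mulmx1 mxtrace_tens1 trD.
rewrite le_eqVlt; apply/orP; left; apply/eqP; congr (_ * (_ * _)); first by ring.
by apply: eq_bigr => i _; rewrite div1r expr2 invfM.
Qed.

End LoewnerOrder.

(** * Two inequalities for the exponential *)

Section Exponential.
Set Implicit Arguments. Unset Strict Implicit.
Context {R : realType}.

(** Each [expR (a i)] lies above the tangent line of the exponential at the mean [m], and the
    weighted tangent values sum to [expR m]. *)
Lemma expR_jensen (I : finType) (p a : I -> R) : (forall i, 0 <= p i) -> \sum_i p i = 1 ->
  expR (\sum_i p i * a i) <= \sum_i p i * expR (a i).
Proof.
move=> p0 p1; set m := \sum_i p i * a i.
have -> : expR m = \sum_i p i * (expR m * (1 + (a i - m))).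
  under eq_bigr => i _ do rewrite mulrCA; rewrite -mulr_sumr.
  under eq_bigr => i _ do rewrite mulrDr mulr1 mulrBr.
  by rewrite big_split/= sumrB p1 -mulr_suml p1 mul1r -/m subrr addr0 mulr1.
apply: ler_sum => i _; rewrite ler_wpM2l// -[a i in leRHS](subrKC m) expRD.
by rewrite ler_wpM2l ?expR_ge0// expR_ge1Dx.
Qed.

(** [expR 1] is at least [(3 / 2) ^+ 2 = 9 / 4], and [81 / 16] exceeds [5]. *)
Lemma sqrt5_le_expR (t : R) : 1 <= t -> Num.sqrt 5 <= expR t.
Proof.
move=> t1; have h : 3 / 2 <= expR 2^-1 :> R.
  by apply: le_trans (expR_ge1Dx _); lra.
rewrite (le_trans _ (_ : expR 1 <= _)) ?ler_expR//.
have -> : expR 1 = expR 2^-1 ^+ 2 :> R by rewrite expr2 -expRD; congr expR; lra.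
have s5 : Num.sqrt (5 : R) ^+ 2 = 5 by rewrite sqr_sqrtr.
have s0 : 0 <= Num.sqrt (5 : R) by rewrite sqrtr_ge0.
rewrite (@le_trans _ _ (9 / 4))//; last by rewrite expr2; nra.
by rewrite expr2 in s5; nra.
Qed.

End Exponential.

(** * Gaussian integrals and squares of subgaussian variables *)

Section Gauss.
Set Implicit Arguments. Unset Strict Implicit.
Context {R : realType}.
Notation leb := (@lebesgue_measure R).

Lemma measurable_gauss (c m : R) : measurable_fun [set: R]
  (EFin \o (fun t : R => normal_peak 1 * expR (- c * t ^+ 2 + t * m))).
Proof.
apply/measurable_EFinP; apply: measurable_funM => //.
apply: measurableT_comp => //; apply: measurable_funD.
  by apply: measurable_funM => //; exact: measurable_funX.
exact: measurable_funM.
Qed.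

Lemma gaussian_mgf (m : R) :
  (\int[leb]_t (normal_peak 1 * expR (- 2^-1 * t ^+ 2 + t * m))%:E = (expR (m ^+ 2 / 2))%:E)%E.
Proof.
transitivity (\int[leb]_t ((expR (m ^+ 2 / 2))%:E * (normal_pdf m 1 t)%:E))%E.
  apply: eq_integral => t _; rewrite -EFinM; congr (_%:E).
  rewrite normal_pdfE ?oner_eq0//= /normal_fun [RHS]mulrCA -expRD.
  by congr (_ * expR _); rewrite expr1n; field.
rewrite integralZl//=; last exact: integrable_normal_pdf.
by rewrite integral_normal_pdf mule1.
Qed.

(** Up to the factor [Num.sqrt 5], the integrand is the centered normal density of variance [5]. *)
Lemma gaussian_integral5 :
  (\int[leb]_t (normal_peak 1 * expR (- 10^-1 * t ^+ 2))%:E = (Num.sqrt 5)%:E)%E.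
Proof.
have s0 : Num.sqrt (5 : R) != 0 by rewrite gt_eqF// sqrtr_gt0.
have expE (t : R) : - 10^-1 * t ^+ 2 = - t ^+ 2 / (5 *+ 2).
  by rewrite -[5 *+ 2]mulr_natr; field.
have s5 : Num.sqrt (5 : R) ^+ 2 = 5 by rewrite sqr_sqrtr.
transitivity (\int[leb]_t ((Num.sqrt 5)%:E * (normal_pdf 0 (Num.sqrt 5) t)%:E))%E.
  apply: eq_integral => t _; rewrite -EFinM; congr (_%:E).
  rewrite normal_pdfE//= /normal_fun [RHS]mulrA subr0 s5; congr (_ * expR _).
    rewrite /normal_peak s5 expr1n mul1r -mulrnAr [Num.sqrt (5 * _)]sqrtrM;
      last by rewrite ler0n.
    by rewrite invfM mulrA divff// mul1r.
  exact: expE.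
rewrite integralZl//=; last exact: integrable_normal_pdf.
by rewrite integral_normal_pdf mule1.
Qed.

Context d (Omega : measurableType d) (P : probability Omega R).

(** With [a ^+ 2 = 2 * l], [expR (l * x ^+ 2)] is the mean of [expR (t * a * x)] over a standard
    Gaussian [t]. After Tonelli, the subgaussian bound costs [l * sigma ^+ 2 * t ^+ 2], at most
    [2 / 5 * t ^+ 2], which leaves the exponent [- t ^+ 2 / 10]. *)
Lemma subgaussian_square_mgf (X : Omega -> R) (sigma l : R) :
  measurable_fun setT X ->
  (forall s, (\int[P]_w (expR (s * X w))%:E <= (expR (s ^+ 2 * sigma ^+ 2 / 2))%:E)%E) ->
  0 <= l -> l * sigma ^+ 2 <= 2 / 5 ->
  (\int[P]_w (expR (l * X w ^+ 2))%:E <= (Num.sqrt 5)%:E)%E.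
Proof.
move=> mX subX l0 ls; pose a := Num.sqrt (2 * l).
have aa : a ^+ 2 = 2 * l by rewrite sqr_sqrtr// mulr_ge0.
pose f (z : Omega * R) : \bar R :=
  (normal_peak 1 * expR (- 2^-1 * z.2 ^+ 2 + z.2 * (a * X z.1)))%:E.
have mf : measurable_fun setT f.
  apply/measurable_EFinP; apply: measurable_funM => //.
  apply: measurableT_comp => //; apply: measurable_funD.
    by apply: measurable_funM => //; exact: measurable_funX.
  apply: measurable_funM => //; apply: measurable_funM => //.
  exact: measurableT_comp.
have f0 z : (0 <= f z)%E by rewrite lee_fin mulr_ge0 ?normal_peak_ge0 ?expR_ge0.
have aE (x : R) : l * x ^+ 2 = (a * x) ^+ 2 / 2 by rewrite exprMn aa; field.
have -> : (\int[P]_w (expR (l * X w ^+ 2))%:E = \int[leb]_t \int[P]_w f (w, t))%E.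
  transitivity (\int[P]_w \int[leb]_t f (w, t))%E.
    by apply: eq_integral => w _; rewrite aE -gaussian_mgf.
  exact: (@fubini_tonelli _ _ _ _ R P (@lebesgue_measure R) f mf f0).
rewrite -gaussian_integral5.
have inner (t : R) :
    (\int[P]_w f (w, t) <= (normal_peak 1 * expR (- 10^-1 * t ^+ 2))%:E)%E.
  rewrite /f /=.
  have mE : measurable_fun setT (EFin \o (fun w => expR (t * a * X w))).
    apply/measurable_EFinP; apply: measurableT_comp => //.
    by apply: measurable_funM.
  have -> : (\int[P]_w (normal_peak 1 * expR (- 2^-1 * t ^+ 2 + t * (a * X w)))%:E =
      (normal_peak 1 * expR (- 2^-1 * t ^+ 2))%:E * \int[P]_w (expR (t * a * X w))%:E)%E.
    rewrite -ge0_integralZl_EFin//.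
    - by apply: eq_integral => w _; rewrite -EFinM expRD mulrA [t * (a * _)]mulrA.
    - by rewrite mulr_ge0 ?normal_peak_ge0 ?expR_ge0.
  apply: le_trans (lee_wpmul2l _ (subX _)) _.
    by rewrite lee_fin mulr_ge0 ?normal_peak_ge0 ?expR_ge0.
  rewrite -EFinM lee_fin -[X in X <= _]mulrA -expRD.
  rewrite ler_wpM2l ?normal_peak_ge0// ler_expR exprMn aa.
  have : (l * sigma ^+ 2) * t ^+ 2 <= 2 / 5 * t ^+ 2 by rewrite ler_wpM2r ?sqr_ge0.
  lra.
apply: ge0_le_integral => //.
- by move=> t _; apply: integral_ge0.
- exact: measurable_fun_fubini_tonelli_G.
- rewrite (_ : (fun t => _) =
      EFin \o (fun t : R => normal_peak 1 * expR (- 10^-1 * t ^+ 2 + t * 0))).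
    exact: measurable_gauss.
  by apply/funext => t /=; rewrite mulr0 addr0.
Qed.

End Gauss.

(** * Tail bound for the squared norm of a linear image of the noise *)

Section Tail.
Set Implicit Arguments. Unset Strict Implicit.
Context {R : realType} d (Omega : measurableType d) (P : probability Omega R).
Context (q : nat) (eta : Omega -> 'cV[R]_q) (sigma : R)
  (subeta : centered_subgaussian P eta sigma).

Lemma measurable_dot (b : 'cV[R]_q) : measurable_fun setT (fun w => dot b (eta w)).
Proof.
have [meas _ _ _] := subeta.
rewrite (_ : (fun w => _) = (fun w => \sum_i b i 0 * eta w i 0)); last first.
  by apply/funext => w; rewrite dotE.
by apply: measurable_sum => i; apply: measurable_funM.
Qed.

(* For [b = 0] the quotient is the junk value [0] and the bound still holds. *)
Lemma subgaussian_dot (b : 'cV[R]_q) l : 0 <= l -> l * sigma ^+ 2 <= 2 / 5 ->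
  (\int[P]_w (expR (l * (dot b (eta w) ^+ 2 / dot b b)))%:E <= (Num.sqrt 5)%:E)%E.
Proof.
move=> l0 ls; have [_ _ _ mgf] := subeta.
have [->|b0] := eqVneq b 0.
  under eq_integral do rewrite /dot trmx0 !mul0mx !mxE expr0n mul0r mulr0 expR0.
  rewrite integral_cst// mul1e (le_trans (probability_le1 P measurableT))// lee_fin.
  by rewrite -[leLHS]sqrtr1 ler_sqrt// ler1n.
have bb := dot_gt0 b0; pose u := (Num.sqrt (dot b b))^-1 *: b.
have u1 : sqnorm u = 1.
  rewrite sqnormE !dot_linE mulrA -invfM -expr2 sqr_sqrtr ?ltW//.
  by rewrite mulVf// gt_eqF.
have uE w : dot b (eta w) ^+ 2 / dot b b = dot u (eta w) ^+ 2.
  by rewrite dotZl exprMn exprVn sqr_sqrtr ?ltW// mulrC.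
under eq_integral do rewrite uE.
apply: subgaussian_square_mgf l0 ls => [|s]; first exact: measurable_dot.
exact: mgf.
Qed.

Lemma measurable_sum_sqr k (N : 'M[R]_(k, q)) :
  measurable_fun setT (fun w => dot (N *m eta w) (N *m eta w)).
Proof.
rewrite (_ : (fun w => _) = (fun w => \sum_i dot (row i N)^T (eta w) ^+ 2)); last first.
  apply/funext => w; rewrite dotE; apply: eq_bigr => i _.
  by rewrite -expr2 /dot trmxK -row_mul [in RHS]mxE.
by apply: measurable_sum => i; apply: measurable_funX; exact: measurable_dot.
Qed.

Lemma measurable_tail k (N : 'M[R]_(k, q)) c :
  measurable [set w | dot (N *m eta w) (N *m eta w) <= c].
Proof.
rewrite (_ : [set w | _] = (fun w => dot (N *m eta w) (N *m eta w)) @^-1` `]-oo, c]).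
  by rewrite -[X in measurable X]setTI; apply: measurable_sum_sqr.
by apply/seteqP; split => w /=; rewrite in_itv.
Qed.

Lemma subgaussian_tail_pos k (N : 'M[R]_(k, q)) tau t : 0 < tau ->
  sigma ^+ 2 * \tr (N *m N^T) <= tau -> 1 <= t ->
  ((1 - expR (- t))%:E <= P [set w | (dot (N *m eta w) (N *m eta w) <= 5 * t * tau)%R])%E.
Proof.
move=> tau0 Ktau t1; set K := \tr (N *m N^T) in Ktau.
pose b i := (row i N)^T; pose S w := dot (N *m eta w) (N *m eta w).
have KE : K = \sum_i dot (b i) (b i).
  by apply: eq_bigr => i _; rewrite /dot /b trmxK !mxE; apply: eq_bigr => j _; rewrite !mxE.
have SE w : S w = \sum_i dot (b i) (eta w) ^+ 2.
  rewrite /S dotE; apply: eq_bigr => i _.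
  by rewrite -expr2 /dot /b trmxK -row_mul [in RHS]mxE.
have mA := measurable_tail N (5 * t * tau).
have tp : 0 < 5 * t * tau by rewrite !mulr_gt0// (lt_le_trans ltr01).
have K0 : 0 <= K by rewrite KE; apply: sumr_ge0 => i _; exact: dot_ge0.
(* If the trace vanishes then so do all rows of [N], and the weights [p i] below would be
   meaningless; the event is then the whole space. *)
have [Kz|Kn] := eqVneq K 0.
  rewrite (_ : [set w | _] = setT) ?probability_setT ?lee_fin ?gerBl ?expR_ge0//.
  apply/seteqP; split => // w _ /=; rewrite -/(S w) SE big1 ?ltW// => i _.
  have bi0 : dot (b i) (b i) = 0.
    by move: Kz; rewrite KE => /psumr_eq0P; apply=> // j _; exact: dot_ge0.
  by rewrite (dot_eq0 bi0) /dot trmx0 mul0mx mxE expr0n.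
have Kp : 0 < K by rewrite lt_def Kn.
(* This exponent meets both needs: [al * K * sigma ^+ 2 <= 2 / 5], and [al] times the threshold
   [5 * t * tau] is [2 * t]. *)
pose al := 2 / 5 / tau; have al0 : 0 < al by rewrite !divr_gt0.
pose p i := dot (b i) (b i) / K.
have p0 i : 0 <= p i by rewrite divr_ge0// dot_ge0.
have p1 : \sum_i p i = 1 by rewrite -mulr_suml -KE divff.
pose g i w := expR (al * K * (dot (b i) (eta w) ^+ 2 / dot (b i) (b i))).
have mg i : measurable_fun setT (g i).
  apply: measurableT_comp => //; apply: measurable_funM => //.
  by apply: measurable_funM => //; apply: measurable_funX; exact: measurable_dot.
have jensen w : expR (al * S w) <= \sum_i p i * g i w.
  rewrite (_ : al * S w =
      \sum_i p i * (al * K * (dot (b i) (eta w) ^+ 2 / dot (b i) (b i)))).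
    exact: expR_jensen.
  rewrite SE mulr_sumr; apply: eq_bigr => i _; rewrite /p.
  have [->|bi0] := eqVneq (b i) 0; first by rewrite /dot trmx0 !mul0mx !mxE expr0n !mul0r mulr0.
  by field; rewrite Kn gt_eqF// dot_gt0.
have mS : measurable_fun setT (EFin \o (fun w => expR (al * S w))).
  apply/measurable_EFinP; apply: measurableT_comp => //.
  by apply: measurable_funM => //; exact: measurable_sum_sqr.
have mpg i : measurable_fun setT (EFin \o (fun w => p i * g i w)).
  by apply/measurable_EFinP; apply: measurable_funM.
have ES : (\int[P]_w (expR (al * S w))%:E <= (Num.sqrt 5)%:E)%E.
  apply: (@le_trans _ _ (\int[P]_w (\sum_i (p i * g i w)%:E))%E).
    apply: ge0_le_integral => //.
    - by apply: emeasurable_sum.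
    - by move=> w _; rewrite sumEFin lee_fin.
  rewrite ge0_integral_sum//; last first.
    by move=> i w _; rewrite lee_fin mulr_ge0 ?expR_ge0.
  have -> : (Num.sqrt 5)%:E = (\sum_i (p i)%:E * (Num.sqrt (5 : R))%:E)%E.
    by rewrite -ge0_sume_distrl ?sumEFin ?p1 ?mul1e// => i _; rewrite lee_fin.
  apply: lee_sum => i _.
  under eq_integral do rewrite EFinM.
  rewrite ge0_integralZl_EFin//; last 2 first.
  - by move=> w _; rewrite lee_fin expR_ge0.
  - exact/measurable_EFinP.
  apply: lee_wpmul2l; first by rewrite lee_fin.
  apply: subgaussian_dot; first by rewrite mulr_ge0 // ltW.
  have := ler_wpM2l (ltW al0) Ktau; rewrite {2}/al divfK ?gt_eqF//.
  by apply: le_trans; rewrite le_eqVlt; apply/orP; left; apply/eqP; ring.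
have mB : measurable (~` [set w | S w <= 5 * t * tau]) by exact: measurableC.
have PB : (P (~` [set w | (S w <= 5 * t * tau)%R]) <= (expR (- t))%:E)%E.
  (* Markov's inequality for [expR (al * S w)]. Half of the exponent [2 * t] then absorbs the
     constant [Num.sqrt 5], as [1 <= t]. *)
  have : ((expR (2 * t))%:E * P (~` [set w | (S w <= 5 * t * tau)%R]) <= (Num.sqrt 5)%:E)%E.
    rewrite -integral_cst//; apply: le_trans ES.
    apply: (@le_trans _ _ (\int[P]_(w in ~` [set w | (S w <= 5 * t * tau)%R])
        (expR (al * S w))%:E)%E).
      apply: ge0_le_integral => //.
      - by move=> w _; rewrite lee_fin expR_ge0.
      - exact: measurable_funS mS.
      - move=> w /= /negP; rewrite -ltNge => Sw; rewrite lee_fin ler_expR.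
        have := ler_wpM2l (ltW al0) (ltW Sw); apply: le_trans.
        by rewrite le_eqVlt; apply/orP; left; apply/eqP; rewrite /al; field; rewrite gt_eqF.
    apply: (ge0_subset_integral P mB measurableT mS) => // w _.
    by rewrite lee_fin expR_ge0.
  have PBfin : P (~` [set w | S w <= 5 * t * tau]) \is a fin_num by exact: fin_num_measure.
  rewrite -(fineK PBfin) -EFinM !lee_fin expRN => h.
  rewrite -(ler_pM2l (expR_gt0 (2 * t))) (le_trans h)//.
  have -> : expR (2 * t) / expR t = expR t by rewrite -expRN -expRD; congr expR; ring.
  exact: sqrt5_le_expR.
have PAfin : P [set w | S w <= 5 * t * tau] \is a fin_num by exact: fin_num_measure.
move: PB; rewrite probability_setC// -/(S _) -(fineK PAfin) -EFinB !lee_fin; lra.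
Qed.

(** This admits [tau = 0], for instance when [sigma = 0]: the strict case applies to
    [tau + j.+1%:R^-1], and continuity of the measure along the decreasing events gives the
    limit. *)
Lemma subgaussian_tail k (N : 'M[R]_(k, q)) tau t :
  sigma ^+ 2 * \tr (N *m N^T) <= tau -> 1 <= t ->
  ((1 - expR (- t))%:E <= P [set w | (dot (N *m eta w) (N *m eta w) <= 5 * t * tau)%R])%E.
Proof.
move=> Ktau t1; have t0 : 0 < 5 * t by rewrite mulr_gt0// (lt_le_trans ltr01).
have tau0 : 0 <= tau.
  apply: le_trans Ktau; rewrite mulr_ge0 ?sqr_ge0//; apply: sumr_ge0 => i _.
  have := dot_ge0 (row i N)^T; rewrite /dot trmxK !mxE; congr (0 <= _).
  by apply: eq_bigr => j _; rewrite !mxE.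
pose F j := [set w | dot (N *m eta w) (N *m eta w) <= 5 * t * (tau + j.+1%:R^-1)].
have mF j : measurable (F j) by exact: measurable_tail.
have FE : \bigcap_j F j = [set w | dot (N *m eta w) (N *m eta w) <= 5 * t * tau].
  apply/seteqP; split => w /= Fw; last first.
    by move=> j _; apply: le_trans Fw _; rewrite ler_pM2l// lerDl.
  rewrite leNgt; apply/negP; rewrite -ltr_pdivlMl// => /ltr_add_invr[j].
  by rewrite ltr_pdivlMl// ltNge => /negP; apply; exact: Fw.
have Fcvg : P (F j) @[j --> \oo] --> P (\bigcap_j F j).
  apply: nonincreasing_cvg_mu => //.
  - by rewrite (le_lt_trans (probability_le1 P (mF 0%N)))// ltry.
  - exact: bigcap_measurable.
  - move=> i j ij; apply/subsetPset => w /= Fw; apply: le_trans Fw _.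
    by rewrite ler_pM2l// lerD2l lef_pV2 ?posrE// ler_nat.
rewrite -FE -(cvg_lim _ Fcvg)//; apply: lime_ge.
  by apply/cvg_ex; exists (P (\bigcap_j F j)).
apply: nearW => j; apply: subgaussian_tail_pos => //; first by rewrite ltr_wpDl.
by rewrite (le_trans Ktau)// lerDl.
Qed.

End Tail.

(** * The penalized least squares estimator *)

Section Fused.
Set Implicit Arguments. Unset Strict Implicit.
Context {R : realType} (n T E : nat) (src dst : 'I_E -> 'I_T).
Context (m : 'I_T -> nat) (Ct : forall t : 'I_T, 'M[R]_(m t, n)).
Let D := incidence R src dst.
Let L := D^T *m D.
Let M := D *t (1%:M : 'M[R]_n).
Let C := blockdiag Ct.
Let O := obsmx Ct.

Lemma gram_tens1 : M^T *m M = L *t 1%:M.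
Proof. by rewrite trmx_tens tensmx_mul trmx1 mulmx1. Qed.

Definition fused_mx mu := mu *: (M^T *m M) + C^T *m C.

Lemma trmx_fused mu : (fused_mx mu)^T = fused_mx mu.
Proof. by rewrite /fused_mx linearD/= linearZ/= !trmx_mul !trmxK. Qed.

Lemma dot_fused mu z :
  dot z (fused_mx mu *m z) = mu * dot (M *m z) (M *m z) + dot (C *m z) (C *m z).
Proof.
rewrite /fused_mx mulmxDl -scalemxAl dotDr dotZr -!mulmxA.
by rewrite (dot_mulmx M^T) (dot_mulmx C^T) !trmxK.
Qed.

Lemma fused_lower b1 b2 b3 mu z : (2 <= T)%N -> (forall e, src e != dst e) ->
  0 < b1 -> 0 < b2 -> 0 < b3 -> 0 < mu ->
  b1 <= eig L (T - 2) ->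
  b2 <= lambda_min (O^T *m O) / T%:R ->
  2 * specnorm C * specnorm O / Num.sqrt T%:R <= b3 ->
  lbar' b1 b2 b3 mu * dot z z <= dot z (fused_mx mu *m z).
Proof.
move=> T2 ne b10 b20 b30 mu0 Lb1 Ob2 Cb3.
have T0 : (0 : R) < T%:R by rewrite ltr0n (leq_trans _ T2).
have Tn0 : (T%:R : R) != 0 by rewrite gt_eqF.
pose J := repeat_mx (R := R) T n; pose w := J^T *m z.
(* [w] sums the blocks of [z], so [u] repeats their average: it is the orthogonal projection of [z]
   onto the vectors with equal blocks. *)
pose u := T%:R^-1 *: (J *m w).
have JJ : J^T *m J = T%:R%:M := trmx_mul_repeat _ _.
have uu : dot u u = dot w w / T%:R.
  by rewrite !dot_linE dot_mulmx mulmxA JJ mul_scalar_mx dotZl; field.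
have uz : dot u z = dot w w / T%:R.
  by rewrite dotZl dotC dot_mulmx -/w mulrC.
have Cu : C *m u = T%:R^-1 *: (O *m w).
  by rewrite -scalemxAr mulmxA blockdiag_repeat.
clearbody u; pose v := z - u.
have vv : dot v v = dot z z - dot w w / T%:R.
  by rewrite /v !dot_linE (dotC z u) uz uu; ring.
(* The Laplacian inequality tensored with the identity; the form of the tensored projection at [z]
   is [dot v v]. *)
have gap : b1 * dot v v <= dot (M *m z) (M *m z).
  have [_ /(_ z)] := psd_tens1 n (psd_laplacian_gap T2 ne b10 Lb1).
  rewrite -!scaleNr !(tensmx1D, tensmx1Z) tens_scalar1.
  rewrite -mul_repeat_trmx -gram_tens1 !(mulmxDl, =^~ scalemxAl) mul1mx -!mulmxA -/J -/w.
  rewrite vv !dot_linE (dot_mulmx M^T) trmxK (dot_mulmx J z w) -/w; lra.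
have uu0 : 0 <= dot w w / T%:R by rewrite -uu dot_ge0.
pose p := Num.sqrt (dot w w / T%:R); pose r := Num.sqrt (dot v v).
have pp : p ^+ 2 = dot w w / T%:R by rewrite sqr_sqrtr.
have rr : r ^+ 2 = dot v v by rewrite sqr_sqrtr ?dot_ge0.
have sT : Num.sqrt (T%:R : R) ^+ 2 = T%:R by rewrite sqr_sqrtr// ltW.
have sT0 : 0 < Num.sqrt (T%:R : R) by rewrite sqrtr_gt0.
have CuE : dot (C *m u) (C *m u) = dot (O *m w) (O *m w) / T%:R / T%:R.
  by rewrite Cu !dot_linE; field.
have Cu_ge : b2 * p ^+ 2 <= dot (C *m u) (C *m u).
  rewrite pp CuE mulrA ler_pM2r ?invr_gt0//.
  have : lambda_min (O^T *m O) * dot w w <= dot (O *m w) (O *m w).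
    rewrite dot_mulmx mulmxA dotC; apply: lambda_min_le.
    by rewrite trmx_mul trmxK.
  move=> /(ler_wpM2r (ltW (_ : 0 < T%:R^-1))); rewrite invr_gt0 => /(_ T0).
  apply: le_trans; rewrite mulrAC ler_wpM2r ?dot_ge0//.
have Cu_le : dot (C *m u) (C *m u) <= (specnorm O / Num.sqrt T%:R * p) ^+ 2.
  rewrite !exprMn exprVn sT pp CuE mulrA ler_pM2r ?invr_gt0//.
  by rewrite mulrAC ler_pM2r ?invr_gt0// specnorm_le.
have Cv_le : dot (C *m v) (C *m v) <= (specnorm C * r) ^+ 2.
  by rewrite exprMn rr specnorm_le.
have p0 : 0 <= p by rewrite sqrtr_ge0.
have r0 : 0 <= r by rewrite sqrtr_ge0.
have cross : `|dot (C *m u) (C *m v)| <= specnorm O / Num.sqrt T%:R * p * (specnorm C * r).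
  by apply: dot_le => //; rewrite !mulr_ge0 ?specnorm_ge0// invr_ge0 ltW.
have CzE : dot (C *m z) (C *m z) =
    dot (C *m u) (C *m u) + 2 * dot (C *m u) (C *m v) + dot (C *m v) (C *m v).
  have -> : z = u + v by rewrite /v addrC subrK.
  by rewrite mulmxDr !dot_linE (dotC (C *m v)); ring.
have zz : dot z z = p ^+ 2 + r ^+ 2 by rewrite pp rr vv; ring.
rewrite dot_fused zz.
apply: (le_trans (lbar'_quadratic b10 b20 b30 mu0 p0 r0 (dot_ge0 (C *m z)) _)).
  (* The term [|C v|^2] is dropped, and twice the cross term is at least [- b3 * p * r]. *)
  rewrite CzE; have := dot_ge0 (C *m v).
  have : 2 * specnorm C * specnorm O / Num.sqrt T%:R * (p * r) <= b3 * (p * r).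
    by rewrite ler_wpM2r// mulr_ge0.
  have [+ _] := ler_normlP _ _ cross.
  move: (specnorm C) (specnorm O) (Num.sqrt _)^-1 => c o s; lra.
by rewrite lerD2r rr -mulrA ler_pM2l.
Qed.

Context (mu c : R) (mu_ge0 : 0 <= mu) (c_gt0 : 0 < c).
Context (fused_ge : forall z, c * dot z z <= dot z (fused_mx mu *m z)).

(** No differentiation: the solution [xs] of the normal equation exists by invertibility, the
    objective is a quadratic centered at [xs], and comparing its values at [xh] and [xs] forces the
    form at [xh - xs] to be nonpositive. *)
Lemma fused_minimizer y xh :
  (forall z, 1 / 2 * sqnorm (y - C *m xh) + mu / 2 * sqnorm (M *m xh)
          <= 1 / 2 * sqnorm (y - C *m z) + mu / 2 * sqnorm (M *m z)) ->
  fused_mx mu *m xh = C^T *m y.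
Proof.
move=> xhmin; have Au := pos_def_unitmx c_gt0 fused_ge.
pose xs := invmx (fused_mx mu) *m (C^T *m y).
have Axs : fused_mx mu *m xs = C^T *m y by rewrite mulKVmx.
have objE z : 1 / 2 * sqnorm (y - C *m z) + mu / 2 * sqnorm (M *m z) =
    1 / 2 * dot y y - dot (fused_mx mu *m xs) z + 1 / 2 * dot z (fused_mx mu *m z).
  rewrite Axs dot_fused !sqnormE !dot_linE (dotC (C *m z) y) (dot_mulmx C y) dotC.
  by rewrite (dotC z); field.
have h0 : dot (xh - xs) (fused_mx mu *m (xh - xs)) <= 0.
  have := xhmin xs; rewrite !objE mulmxBr !dot_linE.
  rewrite (dotC (fused_mx mu *m xs) xh) (dotC (fused_mx mu *m xs) xs).
  have -> : dot xs (fused_mx mu *m xh) = dot xh (fused_mx mu *m xs).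
    by rewrite dot_mulmx trmx_fused dotC.
  lra.
have /eqP : xh - xs = 0.
  apply: dot_eq0; apply/eqP; rewrite eq_le dot_ge0 andbT.
  by rewrite -(pmulr_rle0 _ c_gt0) (le_trans (fused_ge _)).
by rewrite subr_eq0 => /eqP ->.
Qed.

(** Pairing with [v] makes its quadratic form equal to [mu * dot (M *m v) (M *m x)]; expanding
    [|M v - M x|^2] bounds this by [mu |M x|^2], since [mu |M v|^2] is at most the same form. *)
Lemma fused_bias x v : fused_mx mu *m v = mu *: (M^T *m (M *m x)) ->
  c * dot v v <= mu * dot (M *m x) (M *m x).
Proof.
move=> Av; apply: le_trans (fused_ge v) _.
have E1 : dot v (fused_mx mu *m v) = mu * dot (M *m v) (M *m x).
  by rewrite Av dotZr (dot_mulmx M^T) trmxK.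
have E2 := dot_fused mu v; have C0 := dot_ge0 (C *m v).
have := mulr_ge0 mu_ge0 (dot_ge0 (M *m v - M *m x)).
rewrite !dot_linE (dotC (M *m x) (M *m v)); lra.
Qed.

Lemma fused_error x e xh (N := invmx (fused_mx mu) *m C^T) :
  fused_mx mu *m xh = C^T *m (C *m x + e) ->
  dot (xh - x) (xh - x) <=
    2 * dot (N *m e) (N *m e) + 2 * (mu / c * dot (M *m x) (M *m x)).
Proof.
move=> Axh; have Au := pos_def_unitmx c_gt0 fused_ge.
pose v := invmx (fused_mx mu) *m (mu *: (M^T *m (M *m x))).
have -> : xh - x = N *m e - v.
  (* After multiplication by the invertible matrix, the contributions of [C^T *m C *m x] cancel. *)
  apply: (can_inj (mulKmx Au)).
  rewrite !mulmxBr /N /v -!mulmxA !mulKVmx// Axh mulmxDr {1}/fused_mx mulmxDl.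
  rewrite -scalemxAl -!mulmxA [X in _ - X]addrC opprD addrA.
  by rewrite [X in X - _ - _]addrC addrK.
apply: (le_trans (dotD_le _ _)); rewrite lerD2l ler_pM2l//.
rewrite mulrAC ler_pdivlMr// mulrC; apply: fused_bias.
by rewrite mulKVmx.
Qed.

End Fused.

Theorem theorem1 (R : realType) (n T E : nat) (src dst : 'I_E -> 'I_T)
  (m : 'I_T -> nat) (Ct : forall t : 'I_T, 'M[R]_(m t, n)) (x : 'cV[R]_(T * n))
  (d : measure_display) (Omega : measurableType d) (P : probability Omega R)
  (eta : Omega -> 'cV[R]_(\sum_t m t)) (sigma S_T b1 b2 b3 mu : R)
  (xhat : Omega -> 'cV[R]_(T * n)) :
  (1 <= n)%N -> (2 <= T)%N ->
  (* G is a simple undirected graph on [T], edge e oriented from src e to dst e *)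
  (forall e, src e != dst e) ->
  (forall e1 e2, ((src e1 == src e2) && (dst e1 == dst e2))
                 || ((src e1 == dst e2) && (dst e1 == src e2)) -> e1 = e2) ->
  (* G is connected *)
  (forall a b, connect (graph_adj src dst) a b) ->
  let D := incidence R src dst in
  let L := D^T *m D in
  let M := D *t (1%:M : 'M[R]_n) in
  let C := blockdiag Ct in
  let O := obsmx Ct in
  0 < lambda_min (O^T *m O) ->
  centered_subgaussian P eta sigma ->
  sqnorm (M *m x) <= S_T ->
  0 < b1 -> 0 < b2 -> 0 < b3 ->
  b1 <= eig L (T - 2) ->
  b2 <= lambda_min (O^T *m O) / T%:R ->
  2 * specnorm C * Num.sqrt (lambda_max (O^T *m O)) / Num.sqrt T%:R <= b3 ->
  0 < mu ->
  (forall w z,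
      1 / 2 * sqnorm (C *m x + eta w - C *m xhat w) + mu / 2 * sqnorm (M *m xhat w)
   <= 1 / 2 * sqnorm (C *m x + eta w - C *m z) + mu / 2 * sqnorm (M *m z)) ->
  let lb := Num.max (lbar' b1 b2 b3 mu) (lambda_min (C^T *m C)) in
  [/\ lb <= lambda_min (mu *: (M^T *m M) + C^T *m C),
      0 < lbar' b1 b2 b3 mu,
      (b2 + b3 ^+ 2 / b2 <= mu * b1 -> b2 / 4 <= lbar' b1 b2 b3 mu) &
      forall delta : R, 0 < delta < expR (-1) ->
        exists A : set Omega, [/\ measurable A,
          A `<=` [set w | sqnorm (xhat w - x) <=
             4 * mu / lb * S_T
             + 40 * n%:R * sigma ^+ 2 * specnorm C ^+ 2
               * (\sum_(i < T.-1) 1 / (lb + mu * eig L i) ^+ 2 + 1 / lb ^+ 2)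
               * ln (1 / delta)] &
          ((1 - delta)%:E <= P A)%E]].

Proof.
move=> n1 T2 ne _ _ D L M C O Omin sub Sx b10 b20 b30 Lb1 Ob2 Cb3 mu0 xmin lb.
pose A := fused_mx src dst Ct mu.
have symA : A^T = A := trmx_fused _ _ _ _.
have AE z : dot z (A *m z) = mu * dot (M *m z) (M *m z) + dot (C *m z) (C *m z).
  exact: dot_fused.
have lbar0 : 0 < lbar' b1 b2 b3 mu := lbar'_gt0 b10 b20 b30 mu0.
have lb0 : 0 < lb by rewrite lt_max lbar0.
have symC : (C^T *m C)^T = C^T *m C by rewrite trmx_mul trmxK.
have A_ge z : lb * dot z z <= dot z (A *m z).
  rewrite /lb maxr_pMl ?dot_ge0// ge_max; apply/andP; split.
    (* [specnorm O] unfolds to the square root of [lambda_max] in the hypothesis on [b3]. *)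
    exact: fused_lower.
  rewrite AE; apply: le_trans (lambda_min_le _ symC) _.
  by rewrite -mulmxA dot_mulmx trmxK lerDr mulr_ge0 ?dot_ge0// ltW.
split=> //.
- by apply: lambda_min_ge => //; rewrite muln_gt0 n1 (leq_trans _ T2).
- exact: lbar'_ge.
move=> delta /andP[delta0 delta1].
have Au := pos_def_unitmx lb0 A_ge.
pose N := invmx A *m C^T.
pose Sg := \sum_(i < T) 1 / (lb + mu * eig L i) ^+ 2.
pose tau := sigma ^+ 2 * (specnorm C ^+ 2 * (4 * (n%:R * Sg))).
pose t := ln (1 / delta).
have t1 : 1 <= t.
  rewrite /t div1r lnV ?posrE// lerNr -ler_expR lnK ?posrE//; exact: ltW.
have symA' : (invmx A)^T = invmx A by rewrite trmx_inv symA.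
have psdL : psd L := psd_gram _.
have trN : \tr (N *m N^T) <= specnorm C ^+ 2 * (4 * (n%:R * Sg)).
  apply: le_trans (mxtrace_gram_le _ symA') _; rewrite ler_wpM2l ?sqr_ge0//.
  apply: (trace_inv_sqr_le psdL lb0 (ltW mu0) symA symA' (mulmxV Au) A_ge) => z.
  rewrite AE -gram_tens1 -mulmxA (dot_mulmx M^T) trmxK.
  by rewrite lerDl dot_ge0.
have tail : ((1 - delta)%:E <= P [set w | (dot (N *m eta w) (N *m eta w) <= 5 * t * tau)%R])%E.
  have -> : delta = expR (- t) by rewrite /t div1r lnV ?posrE// opprK lnK.
  by apply: (subgaussian_tail sub _ t1); rewrite /tau ler_wpM2l ?sqr_ge0.
(* The witness is the event on the noise term alone; the error bound then holds at each of its
   points. *)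
eexists; split; [exact: (measurable_tail sub N (5 * t * tau))| |exact: tail].
move=> w /= Nw; rewrite sqnormE.
have Axh := fused_minimizer lb0 A_ge (xmin w).
apply: le_trans (fused_error (ltW mu0) lb0 A_ge Axh) _.
rewrite addrC; apply: lerD.
  have S0 : 0 <= S_T by apply: le_trans Sx; rewrite sqnormE dot_ge0.
  have mulb : 0 <= mu / lb by rewrite divr_ge0 ?ltW.
  rewrite sqnormE in Sx; have := ler_wpM2l mulb Sx; have := mulr_ge0 mulb S0.
  by rewrite -/M -[4 * mu / lb]mulrA; lra.
apply: (@le_trans _ _ (2 * (5 * t * tau))); first by rewrite ler_pM2l.
(* The term of index [T.-1] belongs to the smallest eigenvalue; nonnegativity of that eigenvalue
   bounds the term by [1 / lb ^+ 2]. *)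
have Sg_le : Sg <= \sum_(i < T.-1) 1 / (lb + mu * eig L i) ^+ 2 + 1 / lb ^+ 2.
  pose f i := 1 / (lb + mu * eig L i) ^+ 2.
  have sumS k : (0 < k)%N -> \sum_(i < k) f i = \sum_(i < k.-1) f i + f k.-1.
    by case: k => // k _; rewrite big_ord_recr.
  have T0 : (0 < T)%N by apply: leq_trans T2.
  rewrite /Sg (sumS T)// lerD2l /f.
  have e0 : 0 <= mu * eig L T.-1.
    have Tlast : (T.-1 < T)%N by rewrite prednK.
    have [z [_ <-]] := eig_attained (Ordinal Tlast) psdL.1.
    by rewrite mulr_ge0 ?psdL.2// ltW.
  rewrite !div1r lef_pV2 ?posrE ?exprn_gt0 ?ltr_wpDr//.
  by rewrite ler_pXn2r ?nnegrE ?addr_ge0 ?(ltW lb0)// lerDl.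
(* The constant [40] is [2] from splitting the error, [5] from the tail and [4] from the trace. *)
have -> : 2 * (5 * t * tau) = 40 * n%:R * sigma ^+ 2 * specnorm C ^+ 2 * t * Sg.
  by rewrite /tau; ring.
rewrite [leRHS]mulrAC ler_wpM2l//.
by rewrite mulr_ge0 ?(le_trans ler01 t1)// mulr_ge0 ?sqr_ge0// mulr_ge0 ?sqr_ge0// mulr_ge0.
Qed.
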